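(* Let $H$ be a real separable Hilbert space, let $A,\tilde A\colon H\to H$ be bounded linear operators, let $T>0$, and let $L=(L_t)_{t\geqslant 0}$ be an $H$-valued L\'evy process on a probability space $(\Omega,\mathcal F,\mathsf P)$. Suppose that $L$ is a purely jump process, that is, $L=Z$ in the L\'evy--It\^o decomposition $L_t=bt+W_t+Z_t$. Let $X_J,\tilde X_J\colon\Omega\to\mathcal D_{H,T}$ be the Ornstein--Uhlenbeck processes solving $${\rm d}X_J(t)=AX_J(t)\,{\rm d}t+{\rm d}L_t,\qquad {\rm d}\tilde X_J(t)=\tilde A\tilde X_J(t)\,{\rm d}t+{\rm d}L_t,\qquad X_J(0)=\tilde X_J(0)=0 .$$ If the law of $X_J$ is absolutely continuous with respect to the law of $\tilde X_J$ (as Borel probability measures on $\mathcal D_{H,T}$), then the processes $X_J$ and $\tilde X_J$ are equal to each other almost surely.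
   Context: $\mathcal D_{H,T}$ is the space of $H$-valued c\`adl\`ag functions on $[0,T]$ with the Skorohod metric $d(f,g)=\inf_{\phi}\max\{\sup_{t\in[0,T]}|\phi(t)-t|,\ \sup_{t\in[0,T]}\|f(\phi(t))-g(t)\|\}$, the infimum being over all strictly increasing maps $\phi$ of $[0,T]$ onto itself with $\phi(0)=0$, $\phi(T)=T$; it carries its Borel $\sigma$-algebra, which coincides with the $\sigma$-algebra generated by the point evaluations. The law of a random variable $X\colon\Omega\to\mathcal D_{H,T}$ is $\mathsf P_X(E)=\mathsf P(X^{-1}(E))$. An $H$-valued L\'evy process is a stochastically continuous process $L$ with $L_0=0$ almost surely, independent and stationary increments, and almost surely c\`adl\`ag paths. L\'evy--It\^o decomposition: for a Borel set $E\subset H\setminus\{0\}$ let $\pi_t(E,L)$ be the number of $s\leqslant t$ with $L_s-L_{s-}\in E$, and let $\mu$ be the intensity measure of $L$, so that $\mathsf E[\pi_t(E,L)]=t\mu(E)$ for $E$ bounded below (i.e. at positive distance from $0$); put $\hat\pi_t(E,L)=\pi_t(E,L)-t\mu(E)$. With $H_1$ the unit ball of $H$, $L_t=bt+W_t+Z_t$, where $b\in H$, $W$ is a (possibly degenerate) Wiener process, and the jump part is $Z_t=\int_{H_1}u\,\hat\pi_t({\rm d}u,L)+\int_{H\setminus H_1}u\,\pi_t({\rm d}u,L)$, the first integral being the almost sure limit of integrals over subsets of $H_1$ bounded below (whose complements in $H_1$ decrease to $\{0\}$). Purely jump means $b=0$ and $W=0$. The equations are understood in integral form, e.g. $X_J(t)=\int_0^tAX_J(s)\,{\rm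 d}s+L_t$ for $t\in[0,T]$ almost surely, with $X_J$ having c\`adl\`ag paths. *)

(* Defs.v *)
From HB Require Import structures.
From mathcomp Require Import all_boot all_order all_algebra.
From mathcomp Require Import all_classical all_reals all_analysis.

Set Implicit Arguments.
Unset Strict Implicit.
Unset Printing Implicit Defensive.
Import Order.TTheory GRing.Theory Num.Theory.
Import numFieldNormedType.Exports.
Local Open Scope classical_set_scope.
Local Open Scope ring_scope.

(* A topological space with its Borel sigma-algebra. *)
Notation borel T := (g_sigma_algebraType (@open T)).

Definition separable_space (T : topologicalType) : Prop :=
  exists2 S : set T, countable S & dense S.

Section bochner.
Context d (X : measurableType d) (R : realType) (H : completeNormedModType R).

Definition simple_on (D : set X) (s : X -> H) : Prop :=
  measurable_fun D (s : X -> borel H) /\ finite_set (s @` D).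

(* The level set of 0, which may have infinite measure, contributes 0. *)
Definition simple_integral (mu : {measure set X -> \bar R}) (D : set X)
    (s : X -> H) : H :=
  \sum_(y \in s @` D) (fine (mu (D `&` s @^-1` [set y])) *: y).

(* [f] is Bochner integrable over [D], with integral [v]. The measurability of
   [f] is that of the strong theory when [H] is separable. *)
Definition is_bochner_integral (mu : {measure set X -> \bar R}) (D : set X)
    (f : X -> H) (v : H) : Prop :=
  measurable_fun D (f : X -> borel H) /\
  exists s : nat -> X -> H,
    [/\ forall n, simple_on D (s n),
        forall n (y : H), y != 0 ->
          (mu (D `&` s n @^-1` [set y]) < +oo)%E,
        (\int[mu]_(x in D) (`|f x - s n x|)%:E)%E @[n --> \oo] --> 0%E &
        simple_integral mu D (s n) @[n --> \oo] --> v].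

End bochner.

Section cadlag.
Context (R : realType) (H : completeNormedModType R).

(* Only the values of [f] on [0, T] matter. *)
Definition cadlag (T : R) (f : R -> H) : Prop :=
  (forall t, 0 <= t < T -> f x @[x --> t^'+] --> f t) /\
  (forall t, 0 < t <= T -> cvg (f x @[x --> t^'-])).

Definition jump (f : R -> H) (s : R) : H := f s - lim (f x @[x --> s^'-]).

Definition jump_times (E : set H) (f : R -> H) (t : R) : set R :=
  [set s | 0 < s <= t /\ E (jump f s)].

Definition jump_count (E : set H) (f : R -> H) (t : R) : \bar R :=
  counting (jump_times E f t).

(* The integral of u over E against the jump counting measure of f on [0, t];
   the sum is finite when f is cadlag and E is bounded below. *)
Definition jump_sum (E : set H) (f : R -> H) (t : R) : H :=
  \sum_(s \in jump_times E f t) jump f s.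

(* A function on [0, T] is encoded as a function on R vanishing off [0, T], so
   that [=] is equality of functions on [0, T]. *)
Record cadlag_path (T : R) := CadlagPath {
  path_fun : R -> H ;
  path_cadlag : cadlag T path_fun ;
  path_out : forall t, ~~ (0 <= t <= T) -> path_fun t = 0 }.

Definition time_change (T : R) (phi : R -> R) : Prop :=
  [/\ {in `[0, T] &, {homo phi : x y / x < y}},
      set_fun `[0, T] `[0, T] phi, set_surj `[0, T] `[0, T] phi,
      phi 0 = 0 & phi T = T].

Definition skorohod_dist (T : R) (f g : cadlag_path T) : \bar R :=
  ereal_inf [set Order.max
      (ereal_sup [set (`|phi t - t|)%:E | t in `[0, T]])
      (ereal_sup [set (`|path_fun f (phi t) - path_fun g t|)%:E | t in `[0, T]])
    | phi in time_change T].

Definition skorohod_open (T : R) (U : set (cadlag_path T)) : Prop :=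
  forall f, U f -> exists2 e : R, 0 < e &
    forall g, (skorohod_dist f g < e%:E)%E -> U g.

Section skorohod_space.
Variable T : R.

HB.instance Definition _ := gen_eqMixin (cadlag_path T).
HB.instance Definition _ := gen_choiceMixin (cadlag_path T).

Fact cadlag0 : cadlag T (fun=> 0 : H).
Proof. by split=> t _; [exact: cvg_cst|exact: is_cvg_cst]. Qed.

HB.instance Definition _ := isPointed.Build (cadlag_path T)
  (CadlagPath cadlag0 (fun t _ => erefl)).

Fact skorohod_openT : skorohod_open (@setT (cadlag_path T)).
Proof. by move=> f _; exists 1. Qed.

Fact skorohod_openI : setI_closed (@skorohod_open T).
Proof.
move=> U V oU oV f [/oU[a a0 aU] /oV[b b0 bV]].
exists (Num.min a b); first by rewrite lt_min a0 b0.
move=> g fg; split; [apply: aU|apply: bV]; apply: lt_le_trans fg _.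
- by rewrite lee_fin ge_min lexx.
- by rewrite lee_fin ge_min lexx orbT.
Qed.

Fact skorohod_open_bigU (I : Type) (U : I -> set (cadlag_path T)) :
  (forall i, skorohod_open (U i)) -> skorohod_open (\bigcup_i U i).
Proof.
move=> oU f [i _ /oU[e e0 eU]]; exists e => // g /eU Ug; by exists i.
Qed.

HB.instance Definition _ := isOpenTopological.Build (cadlag_path T)
  skorohod_openT skorohod_openI skorohod_open_bigU.

End skorohod_space.

End cadlag.

Section levy.
Context d (Omega : measurableType d) (R : realType) (P : probability Omega R)
  (H : completeNormedModType R).

Definition independent_family (n : nat) (Y : nat -> Omega -> H) : Prop :=
  forall B : nat -> set (borel H), (forall i, measurable (B i)) ->
    P (\bigcap_(i < n) (Y i @^-1` B i)) = (\prod_(i < n) P (Y i @^-1` B i))%E.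

(* Only the indices t >= 0 matter. *)
Implicit Type L : R -> {RV P >-> borel H}.

Definition increment L (s t : R) (w : Omega) : H := (L t w : H) - L s w.

Definition independent_increments L : Prop :=
  forall (n : nat) (t : nat -> R), 0 <= t 0%N -> nondecreasing_seq t ->
    independent_family n (fun i => increment L (t i) (t i.+1)).

Definition stationary_increments L : Prop :=
  forall s t h : R, 0 <= s -> 0 <= t -> 0 <= h ->
    forall B : set (borel H), measurable B ->
      P (increment L s (s + h) @^-1` B) = P (increment L t (t + h) @^-1` B).

Definition stochastically_continuous L : Prop :=
  forall t e : R, 0 <= t -> 0 < e ->
    P [set w | e < `|increment L t s w|]
      @[s --> within [set s | 0 <= s] (nbhs t)] --> 0%E.

Definition sample_path L (w : Omega) (t : R) : H := L t w.

Definition levy_process L : Prop :=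
  [/\ stochastically_continuous L,
      {ae P, forall w, sample_path L w 0 = 0},
      independent_increments L, stationary_increments L &
      {ae P, forall w, forall T, cadlag T (sample_path L w)}].

Definition bounded_below (E : set H) : Prop :=
  exists2 r : R, 0 < r & forall u, E u -> r <= `|u|.

(* The intensity measure is carried by H \ {0}; the equations determine it. *)
Definition intensity_measure L (mu : {measure set (borel H) -> \bar R}) : Prop :=
  mu [set 0] = 0%E /\
  forall (t : R) (E : set (borel H)), 0 <= t -> measurable E ->
    bounded_below E ->
    (\int[P]_w jump_count E (sample_path L w) t = t%:E * mu E)%E.

Definition unit_ball : set H := [set u | `|u| <= 1].

Definition exhausts_unit_ball (E : nat -> set (borel H)) : Prop :=
  [/\ forall n, measurable (E n), forall n, bounded_below (E n),
      forall n, E n `<=` E n.+1 & \bigcup_n E n = unit_ball `\ 0].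

(* [J] is the integral of u over the unit ball against the compensated jump
   measure pi_t - t mu. The limit does not depend on the sequence [E]. *)
Definition compensated_small_jumps L mu (t : R) (J : Omega -> H) : Prop :=
  exists E, exhausts_unit_ball E /\
  exists m : nat -> H,
    (forall n, is_bochner_integral mu (E n) (fun u : borel H => u : H) (m n)) /\
    {ae P, forall w, (jump_sum (E n) (sample_path L w) t - t *: m n)
                       @[n --> \oo] --> J w}.

Definition big_jumps L (t : R) (w : Omega) : H :=
  jump_sum (~` unit_ball) (sample_path L w) t.

Definition jump_part L mu (Z : R -> Omega -> H) : Prop :=
  forall t, 0 <= t -> exists J, compensated_small_jumps L mu t J /\
    {ae P, forall w, Z t w = J w + big_jumps L t w}.

Definition purely_jump L mu : Prop := jump_part L mu (fun t w => sample_path L w t).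

(* dX = A X dt + dL on [0, T], X(0) = 0. *)
Definition ou_solution (T : R) (A : H -> H) L
    (X : Omega -> cadlag_path H T) : Prop :=
  {ae P, forall w, path_fun (X w) 0 = 0 /\
    forall t, 0 <= t <= T ->
      exists2 v, is_bochner_integral (@lebesgue_measure R) `[0, t]
                   (fun s => A (path_fun (X w) s)) v &
        path_fun (X w) t = v + sample_path L w t}.

End levy.

(* Main.v *)
Require Import Defs.
From mathcomp Require Import all_boot all_order all_algebra.
From mathcomp Require Import all_classical all_reals all_analysis.
From mathcomp Require Import finmap measurable_realfun lra.
Import Order.TTheory GRing.Theory Num.Theory.
Import numFieldNormedType.Exports.
Import HBSimple.
Local Open Scope classical_set_scope.
Local Open Scope ring_scope.

Set Implicit Arguments.
Unset Strict Implicit.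

(* The drift integrals are Lipschitz in time, so the paths of X and X' have the
   same jumps as L.  For a pure jump process, L_t is a function of the jumps up
   to time t alone: a limit of compensated sums of small jumps, plus the sum of
   the big ones.  Hence the equation with drift A', with L_t recovered from the
   jumps of the path, is a property of the path alone; tested against a vector h
   it defines a Borel set of the Skorohod space.  That set has full measure
     under
   the law of X', hence, by absolute continuity, under the law of X.  So X
     solves
   the A'-equation with the same noise as X', for t and h in countable dense
   sets, and Gronwall's lemma gives X = X'. *)

(** * Cadlag paths *)

(** The obstacle is measurability. Absolute continuity transfers Borel sets of paths only, and in
    the Skorohod topology neither evaluation at a time before [T] nor a sum of jumps up to a fixed
    time is continuous in the path. What does define an open set is having more than a given number
    of jumps after a given time with sizes in an open set away from 0: a small time change matches
    such jumps injectively, and it never moves the right end [T]. General sums of jumps are reached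
    from these counts by Dynkin's lemma and simple functions. The exhausting sets and the
    compensating vectors are deterministic, so the same reconstruction, applied to [X] and [X'] at
    one outcome, returns the same value of the noise. Its limit along [X] is therefore known before
    any transfer; the transfer only says that the defect of the equation with drift [A'] is zero.
    Testing against vectors keeps everything scalar, and no Bochner integral of [A' X] has to be
    produced. The exceptional null set depends on the time and the vector, which is why countable
    families are needed at the end. *)

Section one_sided_limits.
Context (R : realType).

Lemma near_at_rightP (t : R) (Q : set R) :
  (\forall x \near t^'+, Q x) <->
  exists2 e, 0 < e & forall x, t < x < t + e -> Q x.
Proof.
split=> [/nbhs_ballP[e /= e0 He]|[e e0 He]].
  exists e => // x /andP[tx xe]; apply: He => //.
  by rewrite /ball /= ltr_distlC xe andbT (lt_trans _ tx)// ltrBlDr ltrDl.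
apply/nbhs_ballP; exists e => //= x;
  rewrite /ball /= ltr_distlC => /andP[_ xe] tx.
by apply: He; rewrite tx.
Qed.

Lemma near_at_leftP (t : R) (Q : set R) :
  (\forall x \near t^'-, Q x) <->
  exists2 e, 0 < e & forall x, t - e < x < t -> Q x.
Proof.
split=> [/nbhs_ballP[e /= e0 He]|[e e0 He]].
  exists e => // x /andP[xe tx]; apply: He => //.
  by rewrite /ball /= ltr_distlC xe (lt_trans tx)// ltrDl.
apply/nbhs_ballP; exists e => //= x;
  rewrite /ball /= ltr_distlC => /andP[xe _] tx.
by apply: He; rewrite tx xe.
Qed.

(** Compactness as an induction principle: a finite subcover by the local balls reduces a property
    stable under subsets and finite unions to its local form. *)
Lemma segment_induction (a b : R) (P : set (set R)) :
  P set0 -> (forall U V, P U -> P V -> P (U `|` V)) ->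
  (forall U V, U `<=` V -> P V -> P U) ->
  (forall t, a <= t <= b -> exists2 e, 0 < e & P (ball t e)) ->
  P `[a, b]%classic.
Proof.
move=> P0 PU Psub Ploc.
have /choice[e He] : forall t, exists e, 0 < e /\ (a <= t <= b -> P (ball t e)).
  move=> t; have [/Ploc[e e0 Pe]|tab] := boolP (a <= t <= b).
    by exists e; split.
  by exists 1.
have := @segment_compact R a b; rewrite compact_cover.
move=> /(_ R `[a, b]%classic (fun t => ball t (e t))) [].
- by move=> t _; exact: ball_open.
- move=> t tab; exists t => //; apply: ballxx; exact: (He t).1.
move=> D Dab Dcov; apply: Psub Dcov _.
have : forall t, t \in finmap.enum_fset D -> P (ball t (e t)).
  by move=> t /Dab /set_mem /=; rewrite in_itv /= => /(He t).2.
rewrite /cover bigcup_fset.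
elim: (finmap.enum_fset D) => [|t s IH] Ps; first by rewrite big_nil.
rewrite big_cons; apply: PU; first by apply: Ps; rewrite mem_head.
by apply: IH => u us; apply: Ps; rewrite inE us orbT.
Qed.

End one_sided_limits.

Section cadlag_functions.
Context (R : realType) (H : completeNormedModType R).
Implicit Types (f : R -> H) (T : R).

Lemma cadlag_right T f t e : cadlag T f -> 0 <= t < T -> 0 < e ->
  exists2 d, 0 < d & forall x, t < x < t + d -> `|f x - f t| < e.
Proof.
move=> [fr _] tT e0; have /cvgrPdist_lt /(_ e e0)/near_at_rightP[d d0 Hd] := fr
  t tT.
by exists d => // x /Hd; rewrite distrC.
Qed.

Lemma cadlag_left T f t e : cadlag T f -> 0 < t <= T -> 0 < e ->
  exists2 d, 0 < d & forall x, t - d < x < t -> `|f x - lim (f x @[x -->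
    t^'-])| < e.
Proof.
move=> [_ fl] tT e0; have /cvgrPdist_lt /(_ e e0)/near_at_leftP[d d0 Hd] := fl
  t tT.
by exists d => // x /Hd; rewrite distrC.
Qed.

(** The guards [x <= T] and [0 <= x] treat the end points uniformly: there one side is empty, and a
    dummy radius or limit is supplied. *)
Lemma cadlag_local T f t e : cadlag T f -> 0 <= t <= T -> 0 < e ->
  exists2 d, 0 < d &
    (forall x, x <= T -> t < x < t + d -> `|f x - f t| < e) /\
    (exists l, forall x, 0 <= x -> t - d < x < t -> `|f x - l| < e).
Proof.
move=> cf /andP[t0 tT] e0.
have [d1 d10 H1] : exists2 d, 0 < d &
    forall x, x <= T -> t < x < t + d -> `|f x - f t| < e.
  have [tT'|tT'] := ltP t T.
    have [|d d0 Hd] := @cadlag_right T f t e cf _ e0; first by rewrite t0.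
    by exists d => // x _; exact: Hd.
  by exists 1 => // x xT /andP[/lt_le_trans/(_ xT)]; rewrite ltNge tT'.
have [d2 d20 H2] : exists2 d, 0 < d &
    (exists l, forall x, 0 <= x -> t - d < x < t -> `|f x - l| < e).
  have [t0'|t0'] := ltP 0 t.
    have [|d d0 Hd] := @cadlag_left T f t e cf _ e0; first by rewrite t0'.
    by exists d => //; eexists => x _; exact: Hd.
  by exists 1 => //; exists 0 => x x0 /andP[_ xt]; move: (le_lt_trans x0 xt);
    rewrite ltNge t0'.
exists (Num.min d1 d2); first by rewrite lt_min d10.
split.
  move=> x xT /andP[tx xd]; apply: H1 => //;
    rewrite tx (lt_le_trans xd)// lerD2l.
  by rewrite ge_min lexx.
case: H2 => l Hl; exists l => x x0 /andP[tx xd]; apply: Hl => //;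
  rewrite xd andbT.
by apply: le_lt_trans tx; rewrite lerD2l lerN2 ge_min lexx orbT.
Qed.

Lemma cadlag_bounded T f : cadlag T f ->
  exists2 K, 0 <= K & forall t, 0 <= t <= T -> `|f t| <= K.
Proof.
move=> cf.
have [K HK] : exists K, forall t, `[0, T]%classic t -> 0 <= t <= T -> `|f t| <=
  K.
  apply: (@segment_induction _ _ _ (fun U => exists K, forall t, U t -> 0 <= t
    <= T -> `|f t| <= K)).
  - by exists 0.
  - move=> U V [K1 H1] [K2 H2]; exists (Num.max K1 K2) => t [Ut|Vt] tT.
      by rewrite le_max H1.
    by rewrite le_max H2// orbT.
  - by move=> U V UV [K HK]; exists K => t /UV; exact: HK.
  move=> t tT; have [d d0 [Hr [l Hl]]] := cadlag_local cf tT ltr01.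
  exists d => //; exists (Num.max (`|l| + 1) (`|f t| + 1)) => x.
  rewrite /ball /= ltr_distlC => /andP[tx xt] /andP[x0 xT].
  have close (y z : H) : `|y - z| < 1 -> `|y| <= `|z| + 1.
    move=> yz; rewrite -(subrK z y) addrC (le_trans (ler_normD _ _))//.
    by rewrite lerD2l ltW.
  case: (ltgtP x t) => [xlt|tlx|->].
  - by rewrite le_max (close _ l)// Hl// tx.
  - by rewrite le_max (close _ (f t)) ?orbT// Hr// tlx.
  - by rewrite le_max lerDl ler01 orbT.
exists (Num.max 0 K); first by rewrite le_max lexx.
by move=> t tT; rewrite le_max HK ?orbT.
Qed.

Lemma norm_lim_left_le T f s e l : cadlag T f -> 0 < s <= T ->
  (\forall x \near s^'-, `|f x - l| <= e) ->
  `|lim (f x @[x --> s^'-]) - l| <= e.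
Proof.
move=> [_ fl] sT He.
have cl := fl s sT.
apply: (cvgr_to_le _ He).
by apply: cvg_norm; apply: cvgB => //; exact: cvg_cst.
Qed.

Definition large_jump_times (r T : R) (f : R -> H) : set R :=
  [set s | 0 < s <= T /\ r < `|jump f s|].

(** Near [t] the path stays within [r / 2] of one vector on the left and of [f t] on the right, so
    [t] is the only nearby point that can carry a jump larger than [r]. *)
Lemma finite_large_jump_times r T f : 0 < r -> cadlag T f ->
  finite_set (large_jump_times r T f).
Proof.
move=> r0 cf.
suff: finite_set (`[0, T] `&` large_jump_times r T f).
  apply: sub_finite_set => s [/andP[s0 sT] ?]; split;
    last by rewrite /large_jump_times /= s0.
  by rewrite /= in_itv /= ltW.
apply: (@segment_induction _ _ _ (fun U => finite_set (U `&` large_jump_times r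
  T f))).
- by rewrite set0I.
- by move=> U V fU fV; rewrite setIUl finite_setU.
- by move=> U V UV; apply: sub_finite_set; apply: setSI.
move=> t tT; have r2 : 0 < r / 2 by rewrite divr_gt0.
have [d d0 [Hr [l Hl]]] := cadlag_local cf tT r2.
exists d => //; apply: (@sub_finite_set _ _ [set t]) => // x [].
rewrite /ball /= ltr_distlC => /andP[tx xt] [/andP[x0 xT]].
have small (z : H) : `|f x - z| < r / 2 ->
   (\forall y \near x^'-, `|f y - z| <= r / 2) -> `|jump f x| <= r.
  move=> fx fy; rewrite /jump (splitr r) (le_trans (ler_distD z _ _))//.
  apply: lerD; first exact: ltW.
  by rewrite distrC; apply: norm_lim_left_le cf _ fy; rewrite x0.
case: (ltgtP x t) => // [xlt|tlx]; rewrite ltNge => /negP; case.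
  apply: (small l); first by apply: Hl; [exact: ltW|rewrite tx].
  apply/near_at_leftP; exists (x - Num.max 0 (t - d)).
    by rewrite subr_gt0 gt_max x0 tx.
  move=> y; rewrite subKr gt_max => /andP[/andP[y0 yd] yx]; apply/ltW/Hl.
    exact: ltW. by rewrite yd (lt_trans yx).
apply: (small (f t)); first by apply: Hr; rewrite ?tlx.
apply/near_at_leftP; exists (x - t); first by rewrite subr_gt0.
move=> y; rewrite subKr => /andP[ty yx]; apply/ltW/Hr.
  by rewrite (le_trans (ltW yx)).
by rewrite ty (lt_trans yx).
Qed.

End cadlag_functions.

(** * Borel functions on the Skorohod space *)

Section real_measurability.
Context d (X : measurableType d) (R : realType).

Lemma measurable_fun_ogt (f : X -> R) :
  (forall x, measurable [set w | x < f w]) -> measurable_fun setT f.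
Proof.
move=> mf; apply: (measurability _ (RGenOInfty.measurableE R)).
move=> _ [_ [x ->] <-]; rewrite setTI; have := mf x; congr (measurable _).
by apply/seteqP; split => w /=; rewrite in_itv /= andbT.
Qed.

Lemma measurable_fun_cge (f : X -> R) :
  (forall x, measurable [set w | x <= f w]) -> measurable_fun setT f.
Proof.
move=> mf; apply: (measurability _ (RGenCInfty.measurableE R)).
move=> _ [_ [x ->] <-]; rewrite setTI; have := mf x; congr (measurable _).
by apply/seteqP; split => w /=; rewrite in_itv /= andbT.
Qed.

End real_measurability.

Section borel_sets.
Context (R : realType) (H : completeNormedModType R).

Lemma borel_open (V : ptopologicalType) (U : set V) :
  open U -> measurable (U : set (borel V)).
Proof. by move=> oU; exact: sub_sigma_algebra. Qed.

Lemma continuous_borel_measurable (D : set (borel H)) (g : H -> R) :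
  continuous g -> measurable_fun D (g : borel H -> R).
Proof.
move=> cg; apply: (@measurable_funS _ _ _ _ setT) => //.
apply: measurable_fun_ogt => x; apply: borel_open.
by apply: (open_comp _ (@open_gt R x)) => u _; exact: cg.
Qed.

End borel_sets.

Section skorohod_neighbourhoods.
Context (R : realType) (H : completeNormedModType R) (T : R).
Hypothesis T_gt0 : 0 < T.
Implicit Types (f g : cadlag_path H T) (phi : R -> R).

Lemma skorohod_dist_lt f g (e : R) : (skorohod_dist f g < e%:E)%E ->
  exists2 phi, time_change T phi & forall t, 0 <= t <= T ->
    `|phi t - t| < e /\ `|path_fun f (phi t) - path_fun g t| < e.
Proof.
move=> /ereal_inf_lt[_ [phi tphi <-]]; rewrite gt_max => /andP[h1 h2].
exists phi => // t tT; split; rewrite -lte_fin.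
  by apply: le_lt_trans h1; apply: ereal_sup_ubound; exists t;
    rewrite //= in_itv.
by apply: le_lt_trans h2; apply: ereal_sup_ubound; exists t; rewrite //= in_itv.
Qed.

Lemma time_change_in phi t : time_change T phi -> 0 <= t <= T -> 0 <= phi t <=
  T.
Proof.
by move=> [_ h _ _ _] tT; have := h t; rewrite /= !in_itv /=; apply.
Qed.

Lemma time_change_lt phi x y : time_change T phi -> 0 <= x <= T -> 0 <= y <= T
  ->
  (phi x < phi y) = (x < y).
Proof.
move=> [h _ _ _ _] xT yT;
  have H1 u v : 0 <= u <= T -> 0 <= v <= T -> u < v -> phi u < phi v.
  by move=> uT vT; apply: h; rewrite in_itv.
case: (ltgtP x y) => [/H1->//|/H1 yx|->]; last by rewrite ltxx.
by apply/negbTE; rewrite -leNgt ltW// yx.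
Qed.

Lemma time_change_preimage phi s : time_change T phi -> 0 < s <= T ->
  exists2 r, 0 < r <= T & phi r = s.
Proof.
move=> tphi; have [_ _ h p0 _] := tphi => /andP[s0 sT].
have [|r] := h s; first by rewrite /= in_itv /= ltW.
rewrite /= in_itv /= => /andP[r0 rT] rs; exists r => //; rewrite rT andbT.
by rewrite lt_neqAle r0 andbT; apply: contraTneq s0 => r0';
  rewrite -rs -r0' p0 ltxx.
Qed.

(** Continuity of [phi] is not assumed but follows from surjectivity: a value [v] just below [phi r]
    has a preimage [w], and monotonicity sends []w, r[] into []v, phi r[]. The bound [phi r / 2]
    keeps [v] positive. *)
Lemma time_change_left phi r : time_change T phi -> 0 < r <= T ->
  phi x @[x --> r^'-] --> (phi r)^'-.
Proof.
move=> tphi /andP[r0 rT] U /near_at_leftP[d d0 Hd].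
have r0T : 0 <= r <= T by rewrite ltW.
have /andP[s0 sT] := time_change_in tphi r0T.
have [_ _ _ p0 _] := tphi.
have s0' : 0 < phi r by rewrite -p0 time_change_lt// lexx ltW.
pose v := Num.max (phi r - d) (phi r / 2).
have vs : v < phi r.
  by rewrite /v gt_max ltrBlDr ltrDl d0 ltr_pdivrMr// ltr_pMr// ltr1n.
have [|w /andP[w0 wT] wv] := @time_change_preimage phi v tphi.
  by rewrite lt_max divr_gt0// orbT /= (le_trans (ltW vs)).
have w0T : 0 <= w <= T by rewrite ltW.
apply/near_at_leftP; exists (r - w).
  by rewrite subr_gt0 -(time_change_lt tphi)// wv.
move=> x; rewrite subKr => /andP[wx xr].
have x0T : 0 <= x <= T.
  by rewrite (ltW (lt_trans w0 wx))/= (le_trans (ltW xr)).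
apply: Hd; rewrite time_change_lt// xr andbT.
have : phi w < phi x by rewrite time_change_lt.
by rewrite wv; apply: le_lt_trans; rewrite le_max lexx.
Qed.

(** The value and the left limit each contribute an error [e]. The left limits are comparable
    because [phi] carries left neighbourhoods of [r] into left neighbourhoods of [phi r]. *)
Lemma jump_close f g phi (e : R) r : time_change T phi -> 0 < r <= T ->
  (forall t, 0 <= t <= T -> `|path_fun f (phi t) - path_fun g t| < e) ->
  `|jump (path_fun g) r - jump (path_fun f) (phi r)| <= e *+ 2.
Proof.
move=> tphi /[dup] rT /andP[r0 rT'] He.
have r0T : 0 <= r <= T by rewrite ltW.
have s0T : 0 < phi r <= T.
  have [_ _ _ p0 _] := tphi.
  have /andP[_ ->] := time_change_in tphi r0T.
  by rewrite andbT -{1}p0 time_change_lt// lexx ltW.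
set s := phi r in s0T *.
have lc := norm_lim_left_le (path_cadlag g) rT.
have sl : path_fun f (phi x) @[x --> r^'-] --> lim (path_fun f x @[x --> s^'-]).
  apply: cvg_comp (time_change_left tphi rT) _.
  by have [_] := path_cadlag f; apply.
have -> : jump (path_fun g) r - jump (path_fun f) s = (path_fun g r - path_fun
  f s) -
    (lim (path_fun g x @[x --> r^'-]) - lim (path_fun f x @[x --> s^'-])).
  by rewrite /jump !opprD !opprK addrACA.
rewrite (le_trans (ler_normB _ _))// mulr2n lerD//.
  by rewrite distrC ltW//; have [] := He r r0T.
apply/ler_addgt0Pr => eta eta0; apply: lc.
have /cvgrPdist_lt /(_ eta eta0)/near_at_leftP[d d0 Hd] := sl.
apply/near_at_leftP; exists (r - Num.max 0 (r - d)).
  by rewrite subr_gt0 gt_max r0 ltrBlDr ltrDl.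
move=> x; rewrite subKr gt_max => /andP[/andP[x0 xd] xr].
have xT : 0 <= x <= T by rewrite ltW//= (le_trans (ltW xr)).
rewrite (le_trans (ler_distD (path_fun f (phi x)) _ _))// lerD//.
  by rewrite distrC ltW//; have [] := He x xT.
by rewrite distrC ltW//; apply: Hd; rewrite xd.
Qed.

Lemma open_skorohod (U : set (cadlag_path H T)) : skorohod_open U -> open U.
Proof. by []. Qed.


(** Letting the time range over an open interval absorbs the small displacement caused by a time
    change, which a fixed time would not tolerate. *)
Lemma open_exists_gt (l : H -> R) (a b x : R) : continuous l ->
  0 <= a -> b <= T ->
  open [set f : cadlag_path H T | exists2 s, a < s < b & x < l (path_fun f s)].
Proof.
move=> cl a0 bT; apply: open_skorohod => f [s /andP[as_ sb] xs].
have /nbhs_ballP[eta /= eta0 Heta] : \forall u \near path_fun f s, x < l u.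
  exact: cvgr_gt (cl _) _ xs.
exists (Num.min eta (Num.min (s - a) (b - s))).
  by rewrite !lt_min eta0 !subr_gt0 as_ sb.
move=> g /skorohod_dist_lt[phi tphi He].
have [|r /andP[r0 rT] rs] := @time_change_preimage phi s tphi.
  by rewrite (le_lt_trans a0)//= (le_trans (ltW sb)).
have [|h1 h2] := He r; first by rewrite ltW.
exists r.
  move: h1; rewrite rs !lt_min => /and3P[_ h3 h4].
  move: h3 h4; rewrite !ltr_distl => /andP[_ h3] /andP[h4 _].
  by apply/andP; split; move: h3 h4; lra.
apply: Heta; rewrite -ball_normE /= -rs; apply: lt_le_trans h2 _.
by rewrite ge_min lexx.
Qed.

Lemma open_endpoint_gt (l : H -> R) (x : R) : continuous l ->
  open [set f : cadlag_path H T | x < l (path_fun f T)].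
Proof.
move=> cl; apply: open_skorohod => f /= xs.
have /nbhs_ballP[eta /= eta0 Heta] : \forall u \near path_fun f T, x < l u.
  exact: cvgr_gt (cl _) _ xs.
exists eta => // g /skorohod_dist_lt[phi [_ _ _ _ pT] He].
have [|_] := He T; first by rewrite lexx ltW.
by rewrite pT => h; apply: Heta; rewrite -ball_normE.
Qed.

(** Time changes fix [T], so evaluation there has open superlevel sets. Before [T], right continuity
    turns [x <= l (f t)] into a countable intersection of open conditions on shrinking intervals to
    the right of [t]. *)
Lemma measurable_evaluation (l : H -> R) (t : R) : continuous l -> 0 <= t <= T
  ->
  measurable_fun setT (fun f : borel (cadlag_path H T) => l (path_fun f t)).
Proof.
move=> cl /andP[t0]; rewrite le_eqVlt => /predU1P[->|tT].
  by apply: measurable_fun_ogt => x; apply: borel_open; exact: open_endpoint_gt.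
apply: measurable_fun_cge => x.
pose O n := [set f : cadlag_path H T |
  exists2 s, t < s < t + (T - t) * n.+1%:R^-1 & x - n.+1%:R^-1 < l (path_fun f
    s)].
have Tt : 0 < T - t by rewrite subr_gt0.
have -> : [set f : cadlag_path H T | x <= l (path_fun f t)] = \bigcap_n O n.
  apply/seteqP; split => f.
    move=> /= xf n _.
    have lr : l (path_fun f s) @[s --> t^'+] --> l (path_fun f t).
      by have [h _] := path_cadlag f; apply: cvg_comp (h t _) (cl _);
        rewrite t0.
    have : \forall s \near t^'+, x - n.+1%:R^-1 < l (path_fun f s).
      apply: (cvgr_gt _ lr); apply: lt_le_trans xf.
      by rewrite ltrBlDr ltrDl invr_gt0.
    move=> /near_at_rightP[d d0 Hd].
    have Tn : 0 < (T - t) / n.+1%:R by rewrite divr_gt0.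
    have [m [m0 m1 m2]] : exists m, [/\ 0 < m, m <= d & m <= (T - t) / n.+1%:R].
      exists (Num.min d ((T - t) / n.+1%:R)).
      by rewrite lt_min d0 !ge_min !lexx orbT.
    exists (t + m / 2).
      by move: ((T - t) / n.+1%:R) m2 => q m2; apply/andP; split; lra.
    by apply: Hd; apply/andP; split; lra.
  move=> Of /=; apply/ler_addgt0Pr => e e0.
  have lr : l (path_fun f s) @[s --> t^'+] --> l (path_fun f t).
    by have [h _] := path_cadlag f; apply: cvg_comp (h t _) (cl _); rewrite t0.
  have e2 : 0 < e / 2 by rewrite divr_gt0.
  have /near_at_rightP[d d0 Hd] : \forall s \near t^'+, l (path_fun f s) < l
    (path_fun f t) + e / 2.
    by apply: (cvgr_lt _ lr); rewrite ltrDl.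
  (* The index [n] has to make the tolerance [n.+1%:R^-1] less than [e / 2] and the window
     [(T - t) * n.+1%:R^-1] shorter than [d]. *)
  have m0 : 0 < Num.min (e / 2) (d / (T - t)) by rewrite lt_min e2 divr_gt0.
  have [n _ /(_ n (leqnn n))/=] := near_infty_natSinv_lt (PosNum m0).
  rewrite lt_min => /andP[ne nd].
  have [s /andP[ts sn] xs] := Of n I.
  have : l (path_fun f s) < l (path_fun f t) + e / 2.
    apply: Hd; rewrite ts (lt_trans sn)//= ltrD2l.
    by rewrite mulrC -ltr_pdivlMr.
  move: xs ne; rewrite ltrBlDr => xs ne ls; apply/ltW/(lt_trans xs).
  by rewrite (splitr e) addrA ltrD.
apply: bigcapT_measurable => n; apply: borel_open.
apply: open_exists_gt => //.
by rewrite -lerBrDl ler_piMr ?(ltW Tt)// invf_le1 ?ler1n.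
Qed.

End skorohod_neighbourhoods.

Lemma finite_set_forall_pos (R : realType) (I : choiceType) (A : set I) (Q : I
  -> R -> Prop) :
  finite_set A -> (forall i e e', Q i e -> 0 < e' -> e' <= e -> Q i e') ->
  (forall i, A i -> exists2 e, 0 < e & Q i e) ->
  exists2 e, 0 < e & forall i, A i -> Q i e.
Proof.
move=> /finite_seqP[s ->] Qle; elim: s => [|i s IH] HQ; first by exists 1.
have [|e e0 He] := IH; first by move=> j js; apply: HQ; rewrite /= inE js orbT.
have [|d d0 Hd] := HQ i; first by rewrite /= mem_head.
have m0 : 0 < Num.min e d by rewrite lt_min e0.
exists (Num.min e d) => // j; rewrite /= inE => /orP[/eqP->|js].
  by apply: Qle Hd m0 _; rewrite ge_min lexx orbT.
by apply: Qle (He j js) m0 _; rewrite ge_min lexx.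
Qed.

Lemma cvg_sum_seq (R : realType) (I : Type) (s : seq I) (u : I -> nat -> R) (l
  : I -> R) :
  (forall i, u i n @[n --> \oo] --> l i) ->
  \sum_(i <- s) u i n @[n --> \oo] --> \sum_(i <- s) l i.
Proof.
move=> ul; elim: s => [|i s IH].
  by rewrite big_nil; under eq_fun do rewrite big_nil; exact: cvg_cst.
by rewrite big_cons; under eq_fun do rewrite big_cons; exact: cvgD.
Qed.

(** * Sums over jumps as Borel functions of the path *)

Section jump_functional.
Context (R : realType) (H : completeNormedModType R).

(** Jumps are taken after [c], up to the fixed end [T]: both [c < s] and [r < |jump f s|] are strict
    and survive small perturbations, unlike a condition [s <= t]. *)
Definition jump_functional (r c T : R) (g : H -> R) (f : R -> H) : R :=
  \sum_(s <- fset_set (large_jump_times r T f `&` [set s | c < s])) g (jump f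
    s).

Lemma jump_functional_indic (r c T : R) (V : set H) (f : R -> H) :
  0 < r -> cadlag T f -> jump_functional r c T \1_V f =
  #|` fset_set (large_jump_times r T f `&` [set s | c < s] `&` (jump f @^-1`
    V))|%:R.
Proof.
move=> r0 cf; set A := _ `&` [set s | c < s].
have finA : finite_set A by apply: finite_setIl;
  exact: finite_large_jump_times r0 cf.
rewrite /jump_functional -/A -(fsbig_finite _ (fun s => \1_V (jump f s)))//.
rewrite (eq_fsbigr (fun s => if s \in jump f @^-1` V then 1 else 0));
  last first.
  by move=> s _; rewrite indicE -[s \in _]/(jump f s \in V); case: (_ \in V).
rewrite -fsbig_mkcondr fsbig_finite; last exact: finite_setIl.
by rewrite big_const_seq count_predT iter_addr_0.
Qed.

Section measurability.
Context (T : R) (T_gt0 : 0 < T) (r c : R) (r_gt0 : 0 < r) (c_ge0 : 0 <= c).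

Let fin (f : cadlag_path H T) :
  finite_set (large_jump_times r T (path_fun f) `&` [set s | c < s]).
Proof. by apply: finite_setIl;
  apply: finite_large_jump_times (path_cadlag f). Qed.

Let M (g : H -> R) := measurable_fun setT
  (fun f : borel (cadlag_path H T) => jump_functional r c T g (path_fun f)).

(* Under a time change close to the identity and a uniformly small
   perturbation, each jump counted for [f] is matched by a distinct one of [g],
   so the count is lower semicontinuous. *)
Let M_open (V : set H) : open V -> M \1_V.
Proof.
move=> oV; apply: measurable_fun_ogt => x; apply: borel_open;
  apply: open_skorohod.
move=> f /=; rewrite jump_functional_indic//; last exact: path_cadlag.
set B := fun h : cadlag_path H T =>
  large_jump_times r T (path_fun h) `&` [set s | c < s] `&` (jump (path_fun h)
    @^-1` V).
have finB h : finite_set (B h) by exact: finite_setIl.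
rewrite -/(B f) => xB.
have oW : open (V `&` [set u : H | r < `|u|]).
  apply: openI => //; apply: (open_comp _ (@open_gt R r)) => u _;
    exact: norm_continuous.
have [e e0 He] : exists2 e, 0 < e & forall s, B f s -> c < s - e /\
    forall u : H, `|u - jump (path_fun f) s| <= e *+ 2 -> V u /\ r < `|u|.
  apply: finite_set_forall_pos => //.
    move=> s e e' [ce He] e'0 e'e; split;
      first by rewrite (lt_le_trans ce)// lerD2l lerN2.
    by move=> u ue; apply: He; rewrite (le_trans ue)// lerMn2r.
  move=> s [[[sT rs] cs] Vs].
  have /nbhs_ballP[eta /= eta0 Heta] : nbhs (jump (path_fun f) s) (V `&` [set u
    : H | r < `|u|]).
    exact: open_nbhs_nbhs.
  pose m := Num.min eta (s - c).
  have m0 : 0 < m by rewrite lt_min eta0 subr_gt0.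
  have m1 : m <= eta by rewrite ge_min lexx.
  have m2 : m <= s - c by rewrite ge_min lexx orbT.
  (* Jumps are matched up to twice the distance, and [2 * (m / 3) < eta]; the times move by less
     than [m / 3 < s - c]. *)
  exists (m / 3); first by rewrite divr_gt0.
  split; first by move: (m) m0 m1 m2 cs => /= *; lra.
  move=> u ue; apply: Heta;
    rewrite -ball_normE /= distrC (le_lt_trans ue)// mulr2n.
  by move: (m) m0 m1 => /= *; lra.
exists e => // g /skorohod_dist_lt[phi tphi Hphi].
rewrite jump_functional_indic//; last exact: path_cadlag.
rewrite -/(B g) (lt_le_trans xB)// ler_nat.
apply: (@leq_trans #|` fset_set (phi @` B g)|); last first.
  by rewrite fset_set_image//; exact: leq_imfset_card.
apply: fsubset_leq_card; rewrite -fset_set_sub//; last exact: finite_image.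
move=> s Bs; have [ce Hs] := He s Bs; have [[[sT _] _] _] := Bs.
have [q /[dup] qT /andP[q0 qT'] qs] := time_change_preimage tphi sT.
have [|h1 _] := Hphi q; first by rewrite ltW.
have /Hs[Vq rq] : `|jump (path_fun g) q - jump (path_fun f) s| <= e *+ 2.
  by rewrite -qs; apply: jump_close => // t /Hphi[].
exists q => //; split=> //; split=> //=.
by move: h1; rewrite qs ltr_distl => /andP[_ h]; lra.
Qed.

Let M_eq g h : g =1 h -> M g -> M h.
Proof. by move=> /funext->. Qed.

Let M_sum (I : Type) (s : seq I) (a : I -> R) (g : I -> H -> R) :
  (forall i, M (g i)) -> M (fun u => \sum_(i <- s) a i * g i u).
Proof.
move=> Mg; rewrite /M [X in measurable_fun _ X](_ : _ = fun f : borel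
  (cadlag_path H T) =>
  \sum_(i <- s) a i * jump_functional r c T (g i) (path_fun f)).
  apply: measurable_sum => i; apply: measurable_funM; last exact: Mg.
  exact: measurable_cst.
apply/funext => f; rewrite /jump_functional exchange_big /=.
by apply: eq_bigr => i _; rewrite mulr_sumr.
Qed.

(** For each path the sum is finite and its index set does not depend on [n], so pointwise
    convergence passes to the sums. *)
Let M_lim (g : nat -> H -> R) (h : H -> R) :
  (forall n, M (g n)) -> (forall u, g n u @[n --> \oo] --> h u) -> M h.
Proof.
move=> Mg gh; apply: measurable_fun_cvg => [n|f _]; first exact: Mg.
by apply: cvg_sum_seq => s; exact: gh.
Qed.

Let M_sub g h : M g -> M h -> M (fun u => g u - h u).
Proof.
move=> Mg Mh; rewrite /M [X in measurable_fun _ X](_ : _ = fun f : borel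
  (cadlag_path H T) =>
  jump_functional r c T g (path_fun f) - jump_functional r c T h (path_fun f)).
  exact: measurable_funB.
by apply/funext => f; rewrite /jump_functional sumrB.
Qed.

(** Dynkin's lemma, from the pi-system of open sets: complements are differences, and disjoint
    unions are limits of partial sums. *)
Let M_indic (S : set (borel H)) : measurable S -> M \1_S.
Proof.
move=> mS; apply: (@dynkin_induction _ (borel H) (@open H) (fun S => M \1_S))
  => //.
- exact: openI.
- by apply: M_open; exact: openT.
- move=> A mA MA; apply: M_eq (M_sub (M_open openT) MA) => u.
  by rewrite indicT indicC indicE; case: (u \in A); rewrite ?subrr ?subr0.
move=> F mF tF MF.
apply: (@M_lim (fun n u => \sum_(i < n) 1 * \1_(F i) u)).
  by move=> n; apply: M_sum => i; exact: MF.
move=> u; have [[k _ Fk]|nF] := pselect ((\bigcup_k F k) u).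
  apply: cvg_near_cst; exists k.+1 => //= n kn.
  rewrite indicE mem_set; last by exists k.
  rewrite (bigD1 (Ordinal kn))//= mul1r indicE mem_set//= big1 ?addr0// => i ik.
  rewrite mul1r indicE memNset// => Fi; move: ik; rewrite -val_eqE /= => /eqP;
    apply.
  by apply: tF => //; exists u.
apply: cvg_near_cst; near=> n; rewrite indicE memNset// big1// => i _.
by rewrite mul1r indicE memNset// => Fi; apply: nF; exists i.
Unshelve. all: by end_near. Qed.

Lemma measurable_jump_functional (g : borel H -> R) :
  measurable_fun setT g -> measurable_fun setT
    (fun f : borel (cadlag_path H T) => jump_functional r c T g (path_fun f)).
Proof.
move=> mg; have mg' : measurable_fun setT (EFin \o g) by exact/measurable_EFinP.
have [h hg] := approximation_sfun measurableT mg'.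
change (M g); apply: (@M_lim (fun n u => h n u) g); last first.
  by move=> u; have /fine_cvgP[_] := hg u I.
move=> n; apply: (@M_eq (fun u => \sum_(y <- fset_set (range (h n))) y * \1_(h
  n @^-1` [set y]) u)).
  by move=> u; rewrite fimfunE fsbig_finite.
by apply: M_sum => y; apply: M_indic; exact: measurable_sfunP.
Qed.

End measurability.
End jump_functional.

Section jump_sums.
Context (R : realType) (H : completeNormedModType R) (l : {scalar H}).

(** The jumps in []0, t]] are those in []0, T]] less those in []t, T]]; the cut-off at [r] loses
    none of the jumps in [E]. *)
Lemma jump_sumE (r T t : R) (E : set H) (f : R -> H) :
  0 < r -> cadlag T f -> 0 <= t <= T -> (forall u, E u -> r < `|u|) ->
  l (jump_sum E f t) = jump_functional r 0 T (fun u => l u * \1_E u) f -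
                       jump_functional r t T (fun u => l u * \1_E u) f.
Proof.
move=> r0 cf /andP[t0 tT] Er.
set A := large_jump_times r T f.
have finA : finite_set A := finite_large_jump_times r0 cf.
have A0 : A `&` [set s | 0 < s] = A by apply/setIidPl => s [/andP[]].
have AE : jump_times E f t = A `&` [set s | s <= t /\ E (jump f s)].
  apply/seteqP; split=> s.
    move=> [/andP[s0 st] Es]; split; last by [].
    by split; [rewrite s0 (le_trans st)|exact: Er].
  by move=> [[/andP[s0 _] _] [st Es]]; split=> //; rewrite s0.
rewrite /jump_sum AE fsbig_mkcondr fsbig_finite// raddf_sum /jump_functional
  -/A A0.
rewrite -[X in _ - X](fsbig_finite _ (fun s => l (jump f s) * \1_E (jump f
  s))); last exact: finite_setIl.
rewrite [X in _ - X]fsbig_mkcondr fsbig_finite// -sumrB.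
rewrite !big_seq; apply: eq_bigr => s;
  rewrite in_fset_set// => /set_mem[/andP[s0 sT] _].
case: ifPn => [/set_mem[st Es]|/negP nE].
  by rewrite memNset /= ?subr0 ?indicE ?mem_set ?mulr1//; apply/negP;
    rewrite -leNgt.
rewrite raddf0; have [ts|st] := ltP t s; first by rewrite mem_set// subrr.
rewrite memNset /= ?subr0; last by apply/negP; rewrite -leNgt.
by rewrite indicE memNset ?mulr0// => Es; apply: nE; rewrite mem_set.
Qed.

Lemma measurable_jump_sum (T t : R) (E : set (borel H)) : 0 < T ->
  continuous l -> 0 <= t <= T -> measurable E -> bounded_below E ->
  measurable_fun setT
    (fun f : borel (cadlag_path H T) => l (jump_sum E (path_fun f) t)).
Proof.
move=> T0 cl /[dup] tT /andP[t0 _] mE [q q0 Eq].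
(* [bounded_below] allows [|u| = q], while the cut-off is strict; halving [q] leaves room. *)
have q2 : 0 < q / 2 by rewrite divr_gt0.
have Eq2 u : E u -> q / 2 < `|u| by move=> /Eq; apply: lt_le_trans;
  rewrite ltr_pdivrMr// ltr_pMr// ltr1n.
under eq_fun => f do rewrite (jump_sumE q2 (path_cadlag f) tT Eq2).
have mg : measurable_fun setT (fun u : borel H => l u * \1_E u).
  by apply: measurable_funM;
    [exact: continuous_borel_measurable|exact: measurable_indic].
by apply: measurable_funB; apply: measurable_jump_functional.
Qed.

Lemma eq_jump_sum (E : set H) (f g : R -> H) t :
  (forall s, 0 < s <= t -> jump f s = jump g s) -> jump_sum E f t = jump_sum E
    g t.
Proof.
move=> fg; rewrite /jump_sum; have -> : jump_times E f t = jump_times E g t.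
  by apply/seteqP; split => s [st Es]; split=> //; rewrite ?fg// -fg.
by apply: eq_fsbigr => s /set_mem[st _]; exact: fg.
Qed.

Lemma measurable_unit_ballC : measurable (~` @unit_ball R H : set (borel H)).
Proof.
apply: borel_open; have -> : ~` @unit_ball R H = [set u : H | 1 < `|u|].
  by apply/seteqP; split => u /=; rewrite /unit_ball /= ltNge => /negP.
by apply: (open_comp _ (@open_gt R 1)) => u _; exact: norm_continuous.
Qed.

Lemma bounded_below_unit_ballC : bounded_below (~` @unit_ball R H).
Proof. by exists 1 => // u /negP; rewrite -ltNge => /ltW. Qed.

End jump_sums.

(** * Weak integrals in a Hilbert space *)

Section inner_product.
Context (R : realType) (H : completeNormedModType R) (ip : {dot H for (@idfun
  R)}).
Hypothesis ip_norm : forall x : H, `|x| ^+ 2 = ip x x.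

Lemma cauchy_schwarz (x y : H) : `|ip x y| <= `|x| * `|y|.
Proof.
have [->|y0] := eqVneq y 0; first by rewrite linear0r !normr0 mulr0.
have ipC u v : ip u v = ip v u by rewrite hermC expr0 mul1r.
have y2 : 0 < `|y| ^+ 2 by rewrite exprn_gt0// normr_gt0.
rewrite -(ler_pXn2r (n := 2))// ?nnegrE// ?mulr_ge0// real_normK ?num_real//
  exprMn.
rewrite -subr_ge0 -(pmulr_rge0 _ y2).
(* This vector is [|y| ^+ 2] times the component of [x] orthogonal to [y]; the scaling avoids a
   division. *)
have : 0 <= ip (`|y| ^+ 2 *: x - ip x y *: y) (`|y| ^+ 2 *: x - ip x y *: y).
  by rewrite -ip_norm exprn_ge0.
have Zl a u v : ip (a *: u) v = a * ip u v by exact: linearZl_LR.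
have Zr a u v : ip u (a *: v) = a * ip u v by exact: linearZr_LR.
have Bl u v w : ip (u - v) w = ip u w - ip v w by exact: linearBl.
have Br u v w : ip w (u - v) = ip w u - ip w v by exact: linearBr.
rewrite !(Bl, Br, Zl, Zr) -!ip_norm (ipC y x).
by move: (ip x y) (`|x|) (`|y|) => p a b; nra.
Qed.

Lemma continuous_ip (h : H) : continuous (ip h).
Proof.
move=> x; apply/cvgrPdist_le => e e0.
have h1 : 0 < `|h| + 1 by rewrite ltr_wpDl.
apply/nbhs_ballP; exists (e / (`|h| + 1)); first by rewrite /= divr_gt0.
move=> y; rewrite -ball_normE /= => xy;
  rewrite -linearBr (le_trans (cauchy_schwarz _ _))//.
rewrite (@le_trans _ _ ((`|h| + 1) * `|x - y|))// ?ler_wpM2r ?lerDl//.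
by rewrite mulrC -ler_pdivlMr// ltW.
Qed.

End inner_product.

Lemma scalar_sum (R : pzRingType) (V : lmodType R) (l : {scalar V}) (I : Type)
    (s : seq I) (a : I -> R) (v : I -> V) :
  l (\sum_(i <- s) a i *: v i) = \sum_(i <- s) a i * l (v i).
Proof. by rewrite raddf_sum; apply: eq_bigr => i _; exact: linearZ_LR. Qed.

Section weak_integral.
Context d (X : measurableType d) (R : realType) (H : completeNormedModType R).
Context (mu : {measure set X -> \bar R}) (D : set X) (mD : measurable D).
Hypothesis muD : (mu D < +oo)%E.

Lemma integrable_le_cst (f : X -> R) (K : R) : measurable_fun D f ->
  (forall x, D x -> `|f x| <= K) -> mu.-integrable D (fun x => (f x)%:E).
Proof.
move=> mf fK; apply: measurable_bounded_integrable => //.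
by exists K; split=> [|M KM x Dx /=];
  [exact: num_real|rewrite (le_trans (fK x Dx))// ltW].
Qed.

Let integrable_ind (A : set X) : measurable A -> mu.-integrable D (fun x =>
  (\1_A x)%:E).
Proof.
move=> mA; apply: (@integrable_le_cst _ 1); first exact: measurable_indic.
by move=> x _; rewrite indicE ger0_norm// lern1 leq_b1.
Qed.

Let level (s : X -> H) (y : H) := D `&` s @^-1` [set y].

Lemma measurable_level (s : X -> H) y : simple_on D s -> measurable (level s y).
Proof.
move=> [ms _]; apply: ms => //; rewrite -[X in measurable X]setCK;
  apply: measurableC.
by apply: borel_open; apply: closed_openC; apply: accessible_closed_set1;
  apply: hausdorff_accessible; exact: norm_hausdorff.
Qed.

(** The level and the point are separate arguments of [g], so that one expansion serves both
    [l (s x)] and [|F x - s x|]. The latter is thus measurable level by level, without subtracting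
    two [H]-valued measurable maps. *)
Lemma simple_levels (s : X -> H) (g : H -> X -> R) x : simple_on D s -> D x ->
  g (s x) x = \sum_(y <- fset_set (s @` D)) g y x * \1_(level s y) x.
Proof.
move=> [_ fs] Dx; rewrite (bigD1_seq (s x)) ?fset_uniq//=; last first.
  by rewrite in_fset_set// mem_set.
rewrite indicE mem_set// mulr1 big1 ?addr0// => y ysx.
by rewrite indicE memNset ?mulr0// => -[_ /= /esym]; exact/eqP.
Qed.

Lemma measurable_simple_levels (s : X -> H) (g : H -> X -> R) : simple_on D s ->
  (forall y, measurable_fun D (g y)) -> measurable_fun D (fun x => g (s x) x).
Proof.
move=> ss mg.
apply: (@eq_measurable_fun _ _ _ _ _ (fun x => \sum_(y <- fset_set (s @` D)) g
  y x * \1_(level s y) x)).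
  by move=> x /set_mem Dx; rewrite (simple_levels _ ss Dx).
apply: measurable_sum => y; apply: measurable_funM => //.
exact/measurable_indic/measurable_level.
Qed.

Lemma integral_simple (l : {scalar H}) (s : X -> H) : simple_on D s ->
  mu.-integrable D (fun x => (l (s x))%:E) /\
  (\int[mu]_(x in D) (l (s x))%:E)%E = (l (simple_integral mu D s))%:E.
Proof.
move=> ss; have [_ fs] := ss.
have mL y := measurable_level y ss.
have il y : mu.-integrable D (fun x => (l y)%:E * (\1_(level s y) x)%:E)%E.
  apply: integrableZl => //; exact: integrable_ind.
have lE x : D x -> (l (s x))%:E =
    (\sum_(y <- fset_set (s @` D)) (l y)%:E * (\1_(level s y) x)%:E)%E.
  move=> Dx; rewrite (simple_levels (fun y _ => l y) ss Dx) -sumEFin.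
  by apply: eq_bigr => y _; rewrite EFinM.
split.
  apply: (@eq_integrable _ _ _ _ _ mD
    (fun x => \sum_(y <- fset_set (s @` D)) (l y)%:E * (\1_(level s y)
      x)%:E)%E).
    by move=> x /set_mem Dx; rewrite lE.
  exact: integrable_sum.
rewrite (eq_integral (fun x => \sum_(y <- fset_set (s @` D)) (l y)%:E *
  (\1_(level s y) x)%:E)%E); last first.
  by move=> x /set_mem; exact: lE.
rewrite integral_sum// /simple_integral fsbig_finite// scalar_sum -sumEFin.
apply: eq_bigr => y _; rewrite integralZl//; last exact: integrable_ind.
rewrite integral_indic// setIidl; last by move=> x [].
rewrite mulrC EFinM fineK//.
rewrite ge0_fin_numE// (le_lt_trans _ muD)//; apply: le_measure => [||x []//];
  apply: mem_set.
  exact: mL.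
exact: mD.
Qed.

(** On simple functions [l] commutes with the integral. The error of approximation is at most [C]
    times the L1 distance from [F] to [s n], which tends to 0, and limits are unique. *)
Lemma bochner_integral_scalar (l : {scalar H}) (C : R) (F : X -> H) (v : H) :
  continuous l -> 0 <= C -> (forall u, `|l u| <= C * `|u|) ->
  mu.-integrable D (fun x => (l (F x))%:E) -> is_bochner_integral mu D F v ->
  (l v)%:E = (\int[mu]_(x in D) (l (F x))%:E)%E.
Proof.
move=> cl C0 lC il [mF [s [ss _ sF sv]]].
have fI : (\int[mu]_(x in D) (l (F x))%:E)%E \is a fin_num by exact:
  integrable_fin_num.
rewrite -(fineK fI); congr (_%:E); set I := fine _.
have mFs n : measurable_fun D (fun x => `|F x - s n x|).
  have := @measurable_simple_levels (s n) (fun y x => `|F x - y|) (ss n);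
    apply=> y.
  apply: (@measurableT_comp _ _ _ _ _ _ (fun u : borel H => `|(u : H) - y|) _
    F) => //.
  apply: continuous_borel_measurable => u.
  by apply: cvg_norm; apply: cvgB; [exact: cvg_id|exact: cvg_cst].
have bound n : (`|I - l (simple_integral mu D (s n))|%:E <=
    C%:E * \int[mu]_(x in D) (`|F x - s n x|)%:E)%E.
  have [isn Isn] := integral_simple l (ss n).
  rewrite -abse_EFin EFinB /I fineK// -Isn -integralB//.
  apply: (le_trans (le_abse_integral _ _ _)) => //.
    by apply: measurable_int; exact: integrableB il isn.
  rewrite -ge0_integralZl//; last first.
    exact/measurable_EFinP.
  apply: ge0_le_integral => //.
  - apply: measurableT_comp => //.
    by apply: measurable_int; exact: integrableB il isn.
  - by apply/measurable_EFinP; apply: measurable_funM.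
  by move=> x Dx; rewrite -EFinB /= -raddfB lee_fin lC.
have cs : l (simple_integral mu D (s n)) @[n --> \oo] --> l v.
  exact: cvg_comp sv (cl v).
suff cI : l (simple_integral mu D (s n)) @[n --> \oo] --> I.
  exact: cvg_unique cs cI.
have /fine_cvgP[fs0 s0] := sF.
apply/cvgrPdist_le => e e0.
have : C * fine (\int[mu]_(x in D) (`|F x - s n x|)%:E)%E @[n --> \oo] --> C *
  0.
  exact: cvgMr s0.
rewrite mulr0 => /cvgrPdist_le/(_ e e0) He.
near=> n.
rewrite -lee_fin (le_trans (bound n))//.
have fn : (\int[mu]_(x in D) (`|F x - s n x|)%:E)%E \is a fin_num by near: n.
rewrite -(fineK fn) -EFinM lee_fin.
have : `|0 - C * fine (\int[mu]_(x in D) (`|F x - s n x|)%:E)%E| <= e by near: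
  n.
by rewrite sub0r normrN; apply: le_trans; exact: ler_norm.
Unshelve. all: by end_near. Qed.

End weak_integral.

(** * Riemann sums of bounded right-continuous functions *)

Section riemann_sums.
Context (R : realType) (phi : R -> R) (t K : R).
Hypothesis t_gt0 : 0 < t.
Hypothesis phi_bounded : forall s, 0 <= s <= t -> `|phi s| <= K.
Hypothesis phi_right : forall s, 0 <= s < t -> phi x @[x --> s^'+] --> phi s.

Let mesh n := t / n.+1%:R.

Let mesh_gt0 n : 0 < mesh n. Proof. by rewrite divr_gt0. Qed.

Let mesh_end n : n.+1%:R * mesh n = t.
Proof. by rewrite /mesh mulrCA divff ?mulr1. Qed.

Let cell n i : set R := `[i%:R * mesh n, i.+1%:R * mesh n[%classic.

(** Cells are closed on the left and sampled at their right end, so the sample points approach [s]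
    strictly from the right and right continuity gives convergence at every point. *)
Let step n s : R := \sum_(i < n.+1) phi (i.+1%:R * mesh n) * \1_(cell n i) s.

Let mesh_in n (i : 'I_n.+1) : 0 <= i.+1%:R * mesh n <= t.
Proof.
by rewrite mulr_ge0 ?(ltW (mesh_gt0 n))//= -[leRHS](mesh_end n) ler_pM2r//
  ler_nat.
Qed.

Let stepE n s : 0 <= s < t ->
  exists q, [/\ step n s = phi q, s < q <= s + mesh n & 0 <= q <= t].
Proof.
move=> /andP[s0 st]; pose k := Num.truncn (s / mesh n).
have /andP[ks sk] : k%:R * mesh n <= s < k.+1%:R * mesh n.
  by rewrite -ler_pdivlMr// -ltr_pdivrMr//; apply: truncn_itv;
    rewrite divr_ge0// ltW.
have kn : (k < n.+1)%N.
  rewrite -(ltr_nat R) -(ltr_pM2r (mesh_gt0 n)) mesh_end.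
  exact: le_lt_trans ks st.
exists (k.+1%:R * mesh n); split; last exact: mesh_in (Ordinal kn).
  rewrite /step (bigD1 (Ordinal kn))//= indicE mem_set ?mulr1; last first.
    by rewrite /cell /= in_itv /= ks.
  rewrite big1 ?addr0// => i ik; rewrite indicE memNset ?mulr0//.
  rewrite /cell /= in_itv /= => /andP[is_ si]; move: ik; rewrite -val_eqE /=.
  have := le_lt_trans ks si; have := le_lt_trans is_ sk.
  by rewrite !ltr_pM2r// !ltr_nat !ltnS => h1 h2; rewrite eqn_leq h1 h2.
by rewrite sk/= mulrSr mulrDl mul1r lerD2r.
Qed.

Let step_cvg s : 0 <= s < t -> step n s @[n --> \oo] --> phi s.
Proof.
move=> st; apply/cvgrPdist_lt => e e0.
have /cvgrPdist_lt/(_ e e0)/near_at_rightP[d d0 Hd] := phi_right st.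
have dt : 0 < d / t by rewrite divr_gt0.
near=> n; have [q [-> /andP[sq qs] _]] := stepE n st.
apply: Hd; rewrite sq (le_lt_trans qs)// ltrD2l /mesh mulrC -ltr_pdivlMr//.
by near: n; exact: near_infty_natSinv_lt (PosNum dt).
Unshelve. all: by end_near. Qed.

Let measurable_cell n i (D : set R) : measurable_fun D (\1_(cell n i) : R -> R).
Proof. by apply measurable_indic; exact: measurable_itv. Qed.

Let measurable_step n (D : set R) : measurable_fun D (step n).
Proof.
by apply: measurable_sum => i; exact: measurable_funM.
Qed.

Lemma measurable_right_continuous : measurable_fun `[0, t] phi.
Proof.
apply: (@measurable_fun_itv_cc _ _ _ true true).
apply: (@measurable_fun_cvg _ _ _ _ step) => [n|s /=];
  first exact: measurable_step.
by rewrite in_itv /=; exact: step_cvg.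
Qed.

Let step_integral n : (\int[lebesgue_measure]_(s in `[0%R, t[) (step n s)%:E)%E
  =
  (\sum_(i < n.+1) mesh n * phi (i.+1%:R * mesh n))%:E.
Proof.
under eq_integral do rewrite /step -sumEFin.
have mc i : measurable (cell n i) by exact: measurable_itv.
have fin : (lebesgue_measure (`[0%R, t[%classic : set R) < +oo)%E.
  by rewrite lebesgue_measure_itv /=; case: ifP => _; rewrite ltry.
rewrite integral_sum//; last first.
  move=> i; apply: integrable_le_cst => //.
    by apply: measurable_funM => //; exact: measurable_cell.
  move=> s _; rewrite normrM; apply: (@le_trans _ _ (K * 1)).
    rewrite ler_pM//; first exact: phi_bounded.
    by rewrite indicE ger0_norm// lern1 leq_b1.
  by rewrite mulr1.
rewrite -sumEFin; apply: eq_bigr => i _; under eq_integral do rewrite EFinM.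
rewrite integralZl//; last first.
  apply: (@integrable_le_cst _ _ _ _ _ _ _ _ 1) => //;
    first exact: measurable_cell.
  by move=> s _; rewrite indicE ger0_norm// lern1 leq_b1.
rewrite integral_indic//; last exact: mc.
rewrite setIidl; last first.
  move=> s; rewrite /cell /= !in_itv /= => /andP[h1 h2].
  have /andP[_ h3] := mesh_in i.
  by rewrite (lt_le_trans h2 h3) (le_trans _ h1)// mulr_ge0// ltW.
have cE : lebesgue_measure (cell n i) = (i.+1%:R * mesh n - i%:R * mesh n)%:E.
  by rewrite /cell lebesgue_measure_itv /= lte_fin ltr_pM2r// ltr_nat ltnSn
    -EFinB.
rewrite [X in (_ * X)%E]cE -EFinM.
by rewrite mulrC -mulrBl -natrB// subSnn mul1r.
Qed.

(** Dominated convergence for [step], with the constant bound [K]; the end point [t], which no cell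
    contains, has measure zero. *)
Lemma riemann_sum_cvg :
  \sum_(i < n.+1) t / n.+1%:R * phi (i.+1%:R * (t / n.+1%:R)) @[n --> \oo] -->
  \int[lebesgue_measure]_(s in `[0, t]) phi s.
Proof.
have mphi : measurable_fun `[0, t[ phi.
  by apply: measurable_funS measurable_right_continuous => //;
    apply: subset_itvl; rewrite bnd_simp.
rewrite /Rintegral -integral_itv_bndo_bndc; last exact/measurable_EFinP.
have fin : (lebesgue_measure (`[0%R, t[%classic : set R) < +oo)%E.
  by rewrite lebesgue_measure_itv /=; case: ifP => _; rewrite ltry.
have iphi : lebesgue_measure.-integrable `[0, t[ (fun s => (phi s)%:E).
  apply: (@integrable_le_cst _ _ _ _ _ _ _ _ K) => // s.
  by rewrite /= in_itv /= => /andP[h1 h2]; apply: phi_bounded; rewrite h1 ltW.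
have fI : (\int[lebesgue_measure]_(s in `[0%R, t[) (phi s)%:E)%E \is a fin_num.
  exact: integrable_fin_num.
suff /fine_cvgP[_] : (\int[lebesgue_measure]_(s in `[0%R, t[) (step n s)%:E)%E
  @[n --> \oo] -->
    (fine (\int[lebesgue_measure]_(s in `[0%R, t[) (phi s)%:E)%E)%:E.
  apply: cvg_trans; apply: near_eq_cvg; near=> n.
  by rewrite /= step_integral.
rewrite fineK//.
apply: (@dominated_cvg _ _ _ lebesgue_measure `[0%R, t[%classic (measurable_itv
  _)
  (fun n s => (step n s)%:E) (fun s => (phi s)%:E) (cst K%:E)) => //.
- by move=> n; apply/measurable_EFinP; exact: measurable_step.
- move=> s; rewrite /= in_itv /= => st.
  by apply/fine_cvgP; split; [exact: nearW|exact: step_cvg].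
- by apply: (@integrable_le_cst _ _ _ _ _ _ _ (cst K) `|K|) => //.
move=> n s; rewrite /= in_itv /= => st; rewrite lee_fin.
by have [q [-> _ qt]] := stepE n st; exact: phi_bounded.
Unshelve. all: by end_near. Qed.

End riemann_sums.

(** * Gronwall's lemma for bounded measurable functions *)

Section gronwall.
Context (R : realType).

Lemma integrable_itv_le (i : interval R) (a b K : R) (f : R -> R) :
  [set` i] `<=` `[a, b] -> measurable_fun [set` i] f ->
  (forall s, s \in i -> `|f s| <= K) -> lebesgue_measure.-integrable [set` i]
    (EFin \o f).
Proof.
move=> iab mf fK; rewrite /comp;
  apply: (@integrable_le_cst _ _ _ _ _ _ _ _ K) => //.
apply: (@le_lt_trans _ _ (lebesgue_measure (`[a, b]%classic : set R))).
  by apply: le_measure => //; apply: mem_set; exact: measurable_itv.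
by rewrite lebesgue_measure_itv /=; case: ifP => _; rewrite ltry.
Qed.

Lemma norm_Rintegral_le (f : R -> R) (a b K : R) : a <= b ->
  measurable_fun `]a, b] f -> (forall s, a < s <= b -> `|f s| <= K) ->
  `|\int[lebesgue_measure]_(s in `]a, b]) f s| <= K * (b - a).
Proof.
move=> ab mf fK.
have sub : `]a, b] `<=` `[a, b] by apply: subset_itvr; rewrite bnd_simp.
have int := @integrable_itv_le `]a, b] a b K f sub mf fK.
apply: (le_trans (le_normr_Rintegral _ int)) => //.
apply: (@le_trans _ _ (\int[lebesgue_measure]_(s in `]a, b]) cst K s)).
  apply: le_Rintegral => //.
  - apply: (@integrable_itv_le `]a, b] a b K (fun s => `|f s|) sub).
      exact: measurableT_comp.
    by move=> s sab; rewrite normr_id; exact: fK.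
  - by apply: (@integrable_itv_le `]a, b] a b `|K| (cst K) sub).
rewrite Rintegral_cst//.
suff abE : lebesgue_measure (`]a, b]%classic : set R) = (b - a)%:E.
  by rewrite [X in fine X]abE.
by rewrite lebesgue_measure_itv /= lte_fin EFinB; case: ltgtP ab => // -> _;
  rewrite -EFinB subrr.
Qed.

(** The interval is cut into pieces of length [dl] with [M * dl <= 1 / 2]. Once [y] vanishes up to
    the start of a piece, only the piece contributes to the integral, so each use of the inequality
    halves the bound on [y] there. *)
Lemma gronwall (y : R -> R) (T M K : R) : 0 <= M ->
  measurable_fun `[0, T] y ->
  (forall t, 0 <= t <= T -> 0 <= y t <= K) ->
  (forall t, 0 <= t <= T -> y t <= M * \int[lebesgue_measure]_(s in `[0, t]) y
    s) ->
  forall t, 0 <= t <= T -> y t = 0.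
Proof.
move=> M0 my y0K yM t tT.
(* The summand 1 covers the case [M = 0]. *)
have M1 : 0 < 2 * (M + 1) by lra.
pose dl := (2 * (M + 1))^-1.
have dl0 : 0 < dl by rewrite invr_gt0.
have Mdl : M * dl <= 2^-1.
  by rewrite /dl ler_pdivrMr// mulrA mulVf// mul1r lerDl.
suff H m s : 0 <= s <= T -> s <= m%:R * dl -> y s = 0.
  apply: (H (Num.truncn (t / dl)).+1) => //; case/andP: tT => t0 _.
  by rewrite -ler_pdivrMr// ltW// truncnS_gt.
elim: m s => [s sT|m IH s sT sm].
  rewrite mul0r => s0; have s0' : s = 0 by apply/eqP; rewrite eq_le s0;
    case/andP: sT.
  have := yM s sT; rewrite s0' set_itv1 Rintegral_set1 mulr0.
  by move=> h; apply/eqP; rewrite eq_le h; case/andP: (y0K _ sT); rewrite s0'.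
have [sa|as_] := leP s (m%:R * dl); first exact: IH.
suff H n r : 0 <= r <= T -> r <= m.+1%:R * dl -> y r <= K * 2^-1 ^+ n.
  apply/eqP; rewrite eq_le; case/andP: (y0K s sT) => -> _; rewrite andbT.
  have h2 : `|2^-1 : R| < 1 by rewrite ger0_norm// invf_lt1// ltr1n.
  apply: (cvgr_to_ge (cvg_geometric K h2)); apply: nearW => n; exact: H.
elim: n r => [r rT _|n IHn r rT rm]; first by rewrite expr0 mulr1;
  case/andP: (y0K r rT).
set a := m%:R * dl in IH as_ *.
have a0 : 0 <= a by rewrite mulr_ge0// ltW.
have Kn : 0 <= K * 2^-1 ^+ n.
  by rewrite mulr_ge0 ?exprn_ge0 ?invr_ge0//;
    case/andP: (y0K r rT) => /le_trans h /h.
have [ra|ar] := leP r a;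
  first by rewrite IH// mulr_ge0 ?exprn_ge0 ?invr_ge0//;
    case/andP: (y0K r rT) => /le_trans h /h.
apply: (le_trans (yM r rT)).
have mr : measurable_fun `[0, r] y.
  by apply: measurable_funS my => //; apply: subset_itvl; rewrite bnd_simp;
    case/andP: rT.
have ir : lebesgue_measure.-integrable `[0, r] (EFin \o y).
  apply: (@integrable_itv_le `[0, r] 0 r K) => // u;
    rewrite in_itv /= => /andP[u0 ur].
  have /y0K/andP[h1 h2] : 0 <= u <= T by rewrite u0 (le_trans ur)//;
    case/andP: rT.
  by rewrite ger0_norm.
have -> : \int[lebesgue_measure]_(s0 in `[0, r]) y s0 =
  \int[lebesgue_measure]_(s0 in `]a, r]) y s0.
  rewrite -(@Rintegral_itvB _ y _ _ a ir) ?bnd_simp//; last exact: ltW.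
  suff -> : \int[lebesgue_measure]_(u in `[0, a]) y u = 0 by rewrite subr0.
  rewrite (@eq_Rintegral _ _ _ _ _ (cst 0)) ?Rintegral_cst ?mul0r//.
  move=> u /set_mem/=; rewrite in_itv /= => /andP[u0 ua]; apply: IH => //.
  by rewrite u0 (le_trans ua)// (le_trans (ltW ar))//; case/andP: rT.
apply: (@le_trans _ _ (M * (K * 2^-1 ^+ n * dl))).
  apply: ler_wpM2l => //; apply: (le_trans (ler_norm _)).
  apply: (@le_trans _ _ (K * 2^-1 ^+ n * (r - a))).
    apply: norm_Rintegral_le; first exact: ltW.
      by apply: measurable_funS mr => //; apply: subset_itv; rewrite bnd_simp.
    move=> u /andP[au ur]; have uT : 0 <= u <= T.
      by rewrite (le_trans a0 (ltW au))/= (le_trans ur)//; case/andP: rT.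
    by rewrite ger0_norm; [apply: IHn => //;
      exact: le_trans rm|case/andP: (y0K u uT)].
  by apply: ler_wpM2l => //; rewrite lerBlDl; move: rm;
    rewrite /a mulrSr mulrDl mul1r.
by rewrite mulrCA exprSr [leRHS]mulrA; exact: ler_wpM2l.
Qed.

End gronwall.

(** * Paths of Ornstein-Uhlenbeck equations *)

Section ou_paths.
Context (R : realType) (H : completeNormedModType R) (ip : {dot H for (@idfun
  R)}).
Hypothesis ip_norm : forall x : H, `|x| ^+ 2 = ip x x.
Context (A : {linear H -> H}) (M : R) (M_ge0 : 0 <= M).
Hypothesis AM : forall x, `|A x| <= M * `|x|.
Context (T : R) (T_gt0 : 0 < T).

Let drift (h : H) (f : R -> H) (s : R) : R := ip h (A (f s)).

Lemma continuous_drift h : continuous (fun u => ip h (A u)).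
Proof.
have cA : continuous A.
  apply: bounded_linear_continuous; apply/linear_boundedP; near=> r => x.
  by rewrite (le_trans (AM x))// ler_wpM2r//; near: r; apply: nbhs_pinfty_ge;
    exact: num_real.
by move=> u; apply: (@cvg_comp _ _ _ A (ip h));
  [exact: cA|exact: continuous_ip].
Unshelve. all: by end_near. Qed.

Let drift_le h f K s : `|f s| <= K -> `|drift h f s| <= `|h| * (M * K).
Proof.
move=> fK; rewrite (le_trans (cauchy_schwarz ip_norm _ _))// ler_wpM2l//.
by rewrite (le_trans (AM _))// ler_wpM2l.
Qed.

Let drift_right h f s : cadlag T f -> 0 <= s < T -> drift h f x @[x --> s^'+]
  --> drift h f s.
Proof.
by move=> [fr _] sT; exact: cvg_comp (fr s sT) (@continuous_drift h (f s)).
Qed.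

Let drift_measurable h f t : cadlag T f -> t <= T -> measurable_fun `[0, t]
  (drift h f).
Proof.
move=> cf tT; apply: (@measurable_funS _ _ _ _ (`[0, T]%classic : set R)) => //.
  by apply: subset_itvl; rewrite bnd_simp.
by apply: measurable_right_continuous => // s sT; exact: drift_right.
Qed.

Let drift_integrable h f t : cadlag T f -> t <= T ->
  lebesgue_measure.-integrable `[0, t] (EFin \o drift h f).
Proof.
move=> cf tT; have [K _ fK] := cadlag_bounded cf.
apply: (@integrable_itv_le _ `[0, t] 0 t (`|h| * (M * K))) => //.
  exact: drift_measurable.
move=> s; rewrite in_itv /= => /andP[s0 st]; apply: drift_le; apply: fK.
by rewrite s0 (le_trans st).
Qed.

Lemma drift_riemann_sum h f t : cadlag T f -> 0 < t <= T ->
  \sum_(i < n.+1) t / n.+1%:R * ip h (A (f (i.+1%:R * (t / n.+1%:R)))) @[n -->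
    \oo] -->
  \int[lebesgue_measure]_(s in `[0, t]) ip h (A (f s)).
Proof.
move=> cf /andP[t0 tT]; have [K _ fK] := cadlag_bounded cf.
apply: (@riemann_sum_cvg _ (drift h f) t (`|h| * (M * K))) => // s /andP[s0 st].
  by apply: drift_le; apply: fK; rewrite s0 (le_trans st).
by apply: drift_right => //; rewrite s0 (lt_le_trans st).
Qed.

(** The passage to scalars: beyond this point the integral equation enters only through its pairings
    with vectors [h]. *)
Lemma ou_weak (f ell : R -> H) (h : H) t : cadlag T f -> 0 <= t <= T ->
  (exists2 v, is_bochner_integral (@lebesgue_measure R) `[0, t] (fun s => A (f
    s)) v &
    f t = v + ell t) ->
  ip h (f t - ell t) = \int[lebesgue_measure]_(s in `[0, t]) ip h (A (f s)).
Proof.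
move=> cf /andP[t0 tT] [v bv ->]; rewrite addrK.
have fin : (lebesgue_measure (`[0%R, t]%classic : set R) < +oo)%E.
  by rewrite lebesgue_measure_itv /=; case: ifP => _; rewrite ltry.
have int := drift_integrable h cf tT.
rewrite /Rintegral -(bochner_integral_scalar _ _ _ _ (cauchy_schwarz ip_norm h)
  _ bv)//.
exact: continuous_ip.
Qed.

(** The increment is tested against itself: its squared norm is at most its norm times
    [M * K * (s - u)]. *)
Lemma ou_lipschitz (f ell : R -> H) (K s u : R) : cadlag T f ->
  (forall t, 0 <= t <= T -> `|f t| <= K) ->
  (forall h t, 0 <= t <= T ->
    ip h (f t - ell t) = \int[lebesgue_measure]_(s in `[0, t]) ip h (A (f s)))
      ->
  0 <= u -> u <= s -> s <= T ->
  `|(f s - ell s) - (f u - ell u)| <= M * K * (s - u).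
Proof.
move=> cf fK weak u0 us sT; set h := _ - _.
have K0 : 0 <= K by apply: le_trans (fK 0 _) => //; rewrite lexx ltW.
have [->|h0] := eqVneq h 0; first by rewrite normr0 !mulr_ge0// subr_ge0.
have h0' : 0 < `|h| by rewrite normr_gt0.
rewrite -(ler_pM2l h0') -expr2 ip_norm {2}/h.
have -> : ip h (f s - ell s - (f u - ell u)) = ip h (f s - ell s) - ip h (f u -
  ell u).
  exact: linearBr.
rewrite !weak ?u0 ?(le_trans u0 us) ?(le_trans us sT)//.
rewrite (Rintegral_itvB (drift_integrable h cf sT)) ?bnd_simp//.
rewrite (le_trans (ler_norm _))// mulrA; apply: norm_Rintegral_le => //.
  apply: measurable_funS (drift_measurable h cf sT) => //.
  by apply: subset_itv; rewrite bnd_simp.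
move=> r /andP[ur rs]; apply: drift_le; apply: fK.
by rewrite (le_trans u0 (ltW ur)) (le_trans rs).
Qed.

Lemma ou_jump (f ell : R -> H) s : cadlag T f -> cadlag T ell ->
  (forall h t, 0 <= t <= T ->
    ip h (f t - ell t) = \int[lebesgue_measure]_(s in `[0, t]) ip h (A (f s)))
      ->
  0 < s <= T -> jump f s = jump ell s.
Proof.
move=> cf cl weak /[dup] sT /andP[s0 sT'].
have [K K0 fK] := cadlag_bounded cf.
have c1 : f x - ell x @[x --> s^'-] -->
    lim (f x @[x --> s^'-]) - lim (ell x @[x --> s^'-]).
  by apply: cvgB; [exact: cf.2|exact: cl.2].
have c2 : f x - ell x @[x --> s^'-] --> f s - ell s.
  apply/cvgrPdist_le => e e0.
  have MK : 0 < M * K + 1 by rewrite ltr_wpDl// mulr_ge0.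
  apply/near_at_leftP; exists (Num.min s (e / (M * K + 1))).
    by rewrite lt_min s0 divr_gt0.
  move=> x /andP[sx xs].
  have [x0 xe] : 0 <= x /\ s - x <= e / (M * K + 1).
    have : s - x <= Num.min s (e / (M * K + 1)) by rewrite lerBlDr -lerBlDl ltW.
    by rewrite le_min => /andP[h1 ->]; split=> //;
      rewrite -(lerD2l s) addr0 -lerBlDr.
  rewrite (le_trans (ou_lipschitz cf fK weak x0 (ltW xs) sT'))//.
  rewrite (@le_trans _ _ ((M * K + 1) * (s - x)))//.
    by rewrite ler_wpM2r ?lerDl// subr_ge0 ltW.
  by rewrite mulrC -ler_pdivlMr.
have := cvg_unique (@norm_hausdorff _ H) c1 c2.
rewrite /jump => E; apply/eqP; rewrite -subr_eq0 !opprD !opprK addrACA.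
by rewrite -(E _) addrACA subrr addNr addr0.
Qed.

(* [S] and [D] only need to be dense: [S] because [ip h] is continuous in [h],
   and [D] because both paths are right-continuous. *)
Lemma ou_unique (f g ell : R -> H) (S : set H) (D : set R) :
  dense S -> D T -> (forall a b, 0 <= a -> a < b -> b <= T -> exists2 q, a < q
    < b & D q) ->
  cadlag T f -> cadlag T g -> f 0 = g 0 ->
  (forall h t, 0 <= t <= T ->
    ip h (g t - ell t) = \int[lebesgue_measure]_(s in `[0, t]) ip h (A (g s)))
      ->
  (forall h t, S h -> D t -> 0 < t <= T ->
    ip h (f t - ell t) = \int[lebesgue_measure]_(s in `[0, t]) ip h (A (f s)))
      ->
  forall t, 0 <= t <= T -> f t = g t.
Proof.
move=> dS DT Dd cf cg fg0 weakg weakf.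
have [Kf Kf0 fK] := cadlag_bounded cf.
have [Kg Kg0 gK] := cadlag_bounded cg.
pose y s := `|f s - g s|; pose K := Kf + Kg.
have yK s : 0 <= s <= T -> y s <= K.
  by move=> sT; rewrite (le_trans (ler_normB _ _))// lerD ?fK ?gK.
have K0 : 0 <= K by rewrite addr_ge0.
have yr s : 0 <= s < T -> y x @[x --> s^'+] --> y s.
  by move=> sT; apply: cvg_norm; apply: cvgB; [exact: cf.1|exact: cg.1].
have my t : t <= T -> measurable_fun `[0, t] y.
  move=> tT; apply: (@measurable_funS _ _ _ _ (`[0, T]%classic : set R)) => //.
    by apply: subset_itvl; rewrite bnd_simp.
  exact: measurable_right_continuous.
have yi t : t <= T -> lebesgue_measure.-integrable `[0, t] (EFin \o y).
  move=> tT; apply: (@integrable_itv_le _ `[0, t] 0 t K) => //; first exact: my.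
  move=> s; rewrite in_itv /= => /andP[s0 st]; rewrite normr_id; apply: yK.
  by rewrite s0 (le_trans st).
pose I t := \int[lebesgue_measure]_(s in `[0, t]) y s.
have I0 t : 0 <= I t by apply: Rintegral_ge0 => s _; exact: normr_ge0.
have bound h t : S h -> D t -> 0 < t <= T -> `|ip h (f t - g t)| <= `|h| * (M *
  I t).
  move=> Sh Dt /[dup] tT /andP[t0 tT'].
  have -> : f t - g t = (f t - ell t) - (g t - ell t) by rewrite opprB addrA
    subrK.
  have -> : ip h (f t - ell t - (g t - ell t)) = ip h (f t - ell t) - ip h (g t
    - ell t).
    exact: linearBr.
  rewrite weakf// weakg ?(ltW t0)//.
  rewrite -RintegralB//; [|exact: drift_integrable|exact: drift_integrable].
  have ifg : lebesgue_measure.-integrable `[0, t] (EFin \o (fun s => drift h f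
    s - drift h g s)).
    apply: (@integrable_itv_le _ `[0, t] 0 t (`|h| * (M * Kf) + `|h| * (M *
      Kg))) => //.
      by apply: measurable_funB; exact: drift_measurable.
    move=> s; rewrite in_itv /= => /andP[s0 st].
    have sT : 0 <= s <= T by rewrite s0 (le_trans st).
    by rewrite (le_trans (ler_normB _ _))// lerD// drift_le ?fK ?gK.
  rewrite (le_trans (le_normr_Rintegral _ ifg))// mulrA /I.
  have hM0 : 0 <= `|h| * M by rewrite mulr_ge0.
  rewrite -RintegralZl//; last exact: yi.
  apply: le_Rintegral => //.
  - exact: (integrable_norm ifg).
  - apply: (@integrable_itv_le _ `[0, t] 0 t (`|h| * M * K)) => //.
      by apply: measurable_funM; [exact: measurable_cst|exact: my].
    move=> s; rewrite in_itv /= => /andP[s0 st]; rewrite normrM ger0_norm//.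
    by rewrite ler_wpM2l// normr_id yK// s0 (le_trans st).
  move=> s _ /=.
  have -> : drift h f s - drift h g s = ip h (A (f s - g s)).
    by rewrite raddfB; apply/esym; exact: linearBr.
  by rewrite (le_trans (cauchy_schwarz ip_norm _ _))// -mulrA ler_wpM2l.
have yD t : D t -> 0 < t <= T -> y t <= M * I t.
  move=> Dt tT; have [y0|y0] := eqVneq (y t) 0; first by rewrite y0 mulr_ge0.
  have yp : 0 < y t by rewrite lt_neqAle eq_sym y0 normr_ge0.
  rewrite -(ler_pM2l yp) -expr2 ip_norm.
  set B := M * I t; have B0 : 0 <= B by rewrite mulr_ge0.
  apply/ler_addgt0Pr => e e0.
  (* Replacing the test vector [f t - g t] by some [h] in [S] at distance less than [E] costs
     [E * B] in the bound and [E * y t] in the pairing; together these are [e]. *)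
  have [E [E0 EB]] : exists E, 0 < E /\ E * (B + y t) = e.
    have By : 0 < B + y t by rewrite ltr_wpDl.
    by exists (e / (B + y t)); rewrite divr_gt0// divfK// gt_eqF.
  have [h [/= hy Sh]] : (ball (f t - g t) E `&` S) !=set0.
    by apply: dS; [exists (f t - g t); exact: ballxx|exact: ball_open].
  rewrite -ball_normE /= in hy.
  have -> : ip (f t - g t) (f t - g t) = ip h (f t - g t) + ip (f t - g t - h)
    (f t - g t).
    have -> : ip (f t - g t - h) (f t - g t) = ip (f t - g t) (f t - g t) - ip
      h (f t - g t).
      exact: linearBl.
    by rewrite addrCA subrr addr0.
  have h1 := le_trans (ler_norm _) (bound h t Sh Dt tT).
  have h2 := le_trans (ler_norm _) (cauchy_schwarz ip_norm (f t - g t - h) (f t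
    - g t)).
  have h3 : `|h| <= y t + E.
    rewrite -[h](subKr (f t - g t)) (le_trans (ler_normB _ _))// lerD2l.
    by rewrite ltW.
  have h5 : `|h| * B <= (y t + E) * B by rewrite ler_wpM2r.
  have h6 : `|f t - g t - h| * y t <= E * y t by rewrite ler_wpM2r// ltW.
  rewrite (le_trans (lerD h1 h2))// -EB mulrDr addrA (le_trans (lerD h5 h6))//.
  by rewrite mulrDl lerD2r lerD2r.
have yM t : 0 <= t <= T -> y t <= M * I t.
  (* The time [T] has no points of [D] to its right in the interval, hence the hypothesis [D T]. *)
  move=> /andP[t0]; rewrite le_eqVlt => /predU1P[->|tT];
    first by apply: yD => //; rewrite T_gt0/=.
  apply/ler_addgt0Pr => e e0.
  have e2 : 0 < e / 2 by rewrite divr_gt0.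
  have t0T : 0 <= t < T by rewrite t0.
  have /cvgrPdist_lt/(_ _ e2)/near_at_rightP[d d0 Hd] := yr t t0T.
  have MK : 0 < M * K + 1 by rewrite ltr_wpDl// mulr_ge0.
  (* Moving from [t] to a nearby [q] in [D] changes [y] by less than [e / 2] and increases [M * I]
     by at most [M * K * (q - t) <= e / 2]. *)
  have m0 : t < Num.min T (t + Num.min d (e / 2 / (M * K + 1))).
    by rewrite lt_min tT ltrDl lt_min d0 divr_gt0.
  have [|q /andP[tq]] := Dd _ _ t0 m0; first by rewrite ge_min lexx.
  rewrite lt_min => /andP[qT]; rewrite -ltrBlDl lt_min => /andP[qd qe] Dq.
  have q0T : 0 < q <= T by rewrite (le_lt_trans t0 tq) ltW.
  have h1 : y t < y q + e / 2.
    have /Hd : t < q < t + d by rewrite tq -ltrBlDl.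
    by rewrite ltr_distl addrC => /andP[_]; rewrite addrC.
  have h2 : I q <= I t + K * (q - t).
    rewrite -lerBlDl (Rintegral_itvB (yi q (ltW qT))) ?bnd_simp//;
      last exact: ltW.
    rewrite (le_trans (ler_norm _))//; apply: norm_Rintegral_le;
      first exact: ltW.
      apply: measurable_funS (my q (ltW qT)) => //.
      by apply: subset_itv; rewrite bnd_simp.
    move=> s /andP[ts sq]; rewrite normr_id yK// (le_trans t0 (ltW ts))/=.
    by rewrite (le_trans sq)// ltW.
  have h3 := yD q Dq q0T.
  have h4 : M * I q <= M * (I t + K * (q - t)) by rewrite ler_wpM2l.
  have h5 : (M * K + 1) * (q - t) <= e / 2 by rewrite mulrC -ler_pdivlMr// ltW.
  by move: h1 h3 h4 h5 tq; nra.
move=> t tT; apply/eqP; rewrite -subr_eq0 -normr_eq0; apply/eqP.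
apply: (@gronwall R y T M K M_ge0) => //; first exact: my.
by move=> s sT; rewrite normr_ge0 yK.
Qed.

End ou_paths.

(** * Transfer of the equation between the two laws *)

Lemma measurable_cvg0 d (X : measurableType d) (R : realType) (u : nat -> X ->
  R) :
  (forall n, measurable_fun setT (u n)) ->
  measurable [set w | u n w @[n --> \oo] --> 0].
Proof.
move=> mu; have -> : [set w | u n w @[n --> \oo] --> 0] =
    \bigcap_k \bigcup_N \bigcap_n [set w | `|u (N + n)%N w| < k.+1%:R^-1].
  apply/seteqP; split => w.
    move=> /cvgrPdist_lt uw k _.
    have [|N _ HN] := uw k.+1%:R^-1; first by rewrite invr_gt0.
    exists N => // n _ /=; have := HN (N + n)%N (leq_addr _ _).
    by rewrite /= sub0r normrN.
  move=> uw; apply/cvgrPdist_lt => e e0.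
  have [k _ /(_ k (leqnn k))/= ke] := near_infty_natSinv_lt (PosNum e0).
  have [N _ HN] := uw k I; exists N => // n /= Nn.
  by rewrite sub0r normrN (lt_trans _ ke)// -(subnKC Nn); exact: HN.
apply: bigcapT_measurable => k; apply: bigcupT_measurable => N.
apply: bigcapT_measurable => n.
rewrite [X in measurable X](_ : _ = (fun w => `|u (N + n)%N w|) @^-1` `]-oo,
  k.+1%:R^-1[).
  rewrite -[X in measurable X]setTI.
  by apply: measurableT_comp => //; exact: measurable_itv.
by apply/seteqP; split => w /=; rewrite in_itv.
Qed.

Lemma ae_null_dominates d d' (Omega : measurableType d) (V : measurableType d')
    (R : realType) (P : probability Omega R) (X X' : {RV P >-> V}) (G : set V) :
  distribution P X `<< distribution P X' -> measurable G ->
  {ae P, forall w, G (X' w)} -> {ae P, forall w, G (X w)}.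
Proof.
move=> ac mG aeG; have mGC := measurableC mG.
have mpre (Z : {RV P >-> V}) B : measurable B -> measurable (Z @^-1` B).
  by move=> mB; rewrite -[X in measurable X]setTI; exact: measurable_funPT.
have P'0 : P (X' @^-1` (~` G)) = 0%E by apply/(measure_negligible (mpre X' _
  mGC)).
have P0 : distribution P X (~` G) = 0%E.
  apply: (ac (~` G)) => // B mB BG; apply/eqP.
  rewrite eq_le measure_ge0 andbT -P'0; apply: le_measure => //.
  - exact: mem_set.
  - exact: mem_set.
by exists (X @^-1` (~` G)); split => //; exact: mpre.
Qed.

Lemma cadlag_path_ext (R : realType) (H : completeNormedModType R) (T : R)
    (f g : cadlag_path H T) :
  (forall t, 0 <= t <= T -> path_fun f t = path_fun g t) -> f = g.
Proof.
move=> fg; have : path_fun f = path_fun g.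
  apply/funext => t; have [/fg//|nt] := boolP (0 <= t <= T).
  by rewrite !path_out.
case: f fg => f cf of_; case: g => g cg og /= _ fg.
by subst g; congr CadlagPath; exact: Prop_irrelevance.
Qed.

Lemma countable_sub_range (T : pointedType) (S : set T) : countable S ->
  exists g : nat -> T, S `<=` range g.
Proof.
move=> /countable_injP[f finj];
  exists (fun n => xget point [set x | S x /\ f x = n]).
move=> x Sx; exists (f x) => //.
have [Sy fy] : [set y | S y /\ f y = f x] (xget point [set y | S y /\ f y = f
  x]).
  by apply: (xgetPex point); exists x.
by apply: finj => //; exact: mem_set.
Qed.

Section drift_equation.
Context (R : realType) (H : completeNormedModType R) (ip : {dot H for (@idfun
  R)}).
Hypothesis ip_norm : forall x : H, `|x| ^+ 2 = ip x x.
Context (A : {linear H -> H}) (M : R) (M_ge0 : 0 <= M).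
Hypothesis AM : forall x, `|A x| <= M * `|x|.
Context (T : R) (T_gt0 : 0 < T) (t : R) (tT : 0 < t <= T).
Context (h : H) (E : nat -> set (borel H)) (m : nat -> H).

(* The driving noise is recovered from the jumps of the path.  Riemann sums
   replace the drift integral so that, apart from jump sums, only finitely many
   evaluations occur: this makes the residual a Borel function of the path. *)
Definition residual (f : R -> H) (n : nat) : R :=
  ip h (jump_sum (E n) f t - t *: m n) + ip h (jump_sum (~` @unit_ball R H) f t)
  - ip h (f t) +
  \sum_(i < n.+1) t / n.+1%:R * ip h (A (f (i.+1%:R * (t / n.+1%:R)))).

Lemma measurable_residual n : measurable (E n) -> bounded_below (E n) ->
  measurable_fun setT (fun f : borel (cadlag_path H T) => residual (path_fun f)
    n).
Proof.
move=> mE bE; have /andP[t0 tT'] := tT.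
have t0T : 0 <= t <= T by rewrite ltW.
have cip := @continuous_ip _ _ _ ip_norm h.
have mjs (B : set (borel H)) : measurable B -> bounded_below B ->
  measurable_fun setT
    (fun f : borel (cadlag_path H T) => ip h (jump_sum B (path_fun f) t)).
  by move=> mB bB; exact: (@measurable_jump_sum _ _ (ip h)).
apply: measurable_funD; [apply: measurable_funB; [apply: measurable_funD|]|].
- rewrite [X in measurable_fun _ X](_ : _ = fun f : borel (cadlag_path H T) =>
    ip h (jump_sum (E n) (path_fun f) t) - ip h (t *: m n)); last first.
    by apply/funext => f; exact: linearBr.
  by apply: measurable_funB; [exact: mjs|exact: measurable_cst].
- by apply: mjs; [exact: measurable_unit_ballC|exact: bounded_below_unit_ballC].
- exact: measurable_evaluation.
apply: measurable_sum => i; apply: measurable_funM; first exact: measurable_cst.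
apply: (@measurable_evaluation _ _ _ T_gt0 (fun u => ip h (A u))).
  exact: continuous_drift AM h.
apply/andP; split; first by rewrite mulr_ge0// divr_ge0// ltW.
rewrite mulrCA; apply: le_trans tT'; apply: ler_piMr; first exact: ltW.
by rewrite ler_pdivrMr// mul1r ler_nat.
Qed.

(** The path [f] has to share the jumps of [ell] but need not solve any equation with drift [A]; the
    limit is the defect of [f] in that equation, tested against [h]. So the lemma applies to [X]
    with the drift of [X']. *)
Lemma residual_cvg (f ell : R -> H) (j : H) : cadlag T f ->
  (forall s, 0 < s <= T -> jump f s = jump ell s) ->
  (jump_sum (E n) ell t - t *: m n) @[n --> \oo] --> j ->
  ell t = j + jump_sum (~` @unit_ball R H) ell t ->
  residual f n @[n --> \oo] -->
  - ip h (f t - ell t) + \int[lebesgue_measure]_(s in `[0, t]) ip h (A (f s)).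
Proof.
move=> cf fj jE ellE; have /andP[t0 tT'] := tT.
have js B : jump_sum B f t = jump_sum B ell t.
  by apply: eq_jump_sum => s /andP[s0 st]; apply: fj; rewrite s0 (le_trans st).
rewrite /residual; apply: cvgD;
  last exact: (drift_riemann_sum ip_norm M_ge0 AM cf tT).
have -> : - ip h (f t - ell t) =
    ip h j + ip h (jump_sum (~` @unit_ball R H) ell t) - ip h (f t).
  have -> : ip h (f t - ell t) = ip h (f t) - ip h (ell t) by exact: linearBr.
  rewrite opprB {1}ellE; congr (_ - _); exact: linearDr.
under eq_fun do rewrite !js.
apply: cvgB; last exact: cvg_cst.
apply: cvgD; last exact: cvg_cst.
exact: cvg_comp jE (@continuous_ip _ _ _ ip_norm h j).
Qed.

End drift_equation.

Lemma bounded_by_nonneg (R : realType) (H : normedModType R) (A : H -> H) :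
  (exists M : R, forall x, `|A x| <= M * `|x|) ->
  exists2 M : R, 0 <= M & forall x, `|A x| <= M * `|x|.
Proof.
move=> [M AM]; exists (Num.max 0 M); first by rewrite le_max lexx.
by move=> x; rewrite (le_trans (AM x))// ler_wpM2r// le_max lexx orbT.
Qed.

Theorem theoremB (R : realType)
  (H : completeNormedModType R) (ip : {dot H for (@idfun R)})
  (ip_norm : forall x : H, `|x| ^+ 2 = ip x x)
  (H_separable : separable_space H)
  (A A' : {linear H -> H})
  (A_bounded : exists M : R, forall x, `|A x| <= M * `|x|)
  (A'_bounded : exists M : R, forall x, `|A' x| <= M * `|x|)
  (T : R) (T_gt0 : 0 < T)
  (d : measure_display) (Omega : measurableType d) (P : probability Omega R)
  (L : R -> {RV P >-> borel H}) (L_levy : levy_process L)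
  (mu : {measure set (borel H) -> \bar R}) (mu_intensity : intensity_measure L
    mu)
  (L_jump : purely_jump L mu)
  (X X' : {RV P >-> borel (cadlag_path H T)})
  (X_sol : ou_solution A L X) (X'_sol : ou_solution A' L X')
  (X_ac : distribution P X `<< distribution P X') :
  {ae P, forall w, X w = X' w}.
Proof.
have [M M0 AM] : exists2 M, 0 <= M & forall x, `|A x| <= M * `|x|.
  exact: bounded_by_nonneg.
have [M' M'0 A'M] : exists2 M, 0 <= M & forall x, `|A' x| <= M * `|x|.
  exact: bounded_by_nonneg.
have [_ _ _ _ L_cadlag] := L_levy.
pose good (B : H -> H) (f ell : R -> H) := [/\ cadlag T ell, f 0 = 0,
  forall h t, 0 <= t <= T ->
    ip h (f t - ell t) = \int[lebesgue_measure]_(s in `[0, t]) ip h (B (f s)) &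
  forall s, 0 < s <= T -> jump f s = jump ell s].
have ae_good (B : {linear H -> H}) N (Z : {RV P >-> borel (cadlag_path H T)}) :
    0 <= N -> (forall x, `|B x| <= N * `|x|) -> ou_solution B L Z ->
    {ae P, forall w, good B (path_fun (Z w)) (sample_path L w)}.
  move=> N0 BN Z_sol; apply: filterS2 Z_sol L_cadlag => w [Z0 Zeq] /(_ T) cL.
  have cZ := path_cadlag (Z w).
  have weak h t (tT : 0 <= t <= T) := ou_weak ip_norm N0 BN T_gt0 h cZ tT (Zeq
    t tT).
  by split => // s sT; exact: (ou_jump ip_norm N0 BN T_gt0 cZ cL weak sT).
have X_good := ae_good A M X M0 AM X_sol.
have X'_good := ae_good A' M' X' M'0 A'M X'_sol.
have X_eq t h : 0 < t <= T -> {ae P, forall w,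
    ip h (path_fun (X w) t - sample_path L w t) =
    \int[lebesgue_measure]_(s in `[0, t]) ip h (A' (path_fun (X w) s))}.
  move=> tT; have /andP[t0 tT'] := tT.
  (* The sets [E], the vectors [m] and the limit [J] come from [L] alone and serve both
     processes. *)
  have [J [[E [[mE bE _ _] [m [_ Jae]]]] Lae]] := L_jump t (ltW t0).
  (* The path may solve its equation with any drift [B], while the residual is always formed with
     [A']. *)
  have cvg_res (B : H -> H) (f : cadlag_path H T) w : good B (path_fun f)
    (sample_path L w) ->
      (jump_sum (E n) (sample_path L w) t - t *: m n) @[n --> \oo] --> J w ->
      sample_path L w t = J w + big_jumps L t w ->
      residual ip A' t h E m (path_fun f) n @[n --> \oo] -->
      - ip h (path_fun f t - sample_path L w t) +
      \int[lebesgue_measure]_(s in `[0, t]) ip h (A' (path_fun f s)).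
    move=> [_ _ _ fj] jE ellE.
    exact: (residual_cvg ip_norm M'0 A'M tT (path_cadlag f) fj jE ellE).
  have mG : measurable [set f : borel (cadlag_path H T) |
      residual ip A' t h E m (path_fun f) n @[n --> \oo] --> 0].
    apply: measurable_cvg0 => n.
    by apply: (measurable_residual ip_norm A'M T_gt0 tT).
  have /(ae_null_dominates X_ac mG) : {ae P, forall w,
      residual ip A' t h E m (path_fun (X' w)) n @[n --> \oo] --> 0}.
    apply: filterS3 X'_good Jae Lae => w Xw Jw Lw.
    have := cvg_res _ _ _ Xw Jw Lw; have [_ _ -> //] := Xw; last by rewrite ltW.
    by rewrite addNr.
  move=> X0ae; apply: filterS2 (filterI X_good X0ae) (filterI Jae Lae) => w [Xw
    X0] [Jw Lw].
  (* Along [X] the residual tends to the defect in the equation with drift [A'], and by the transfer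
     also to 0. *)
  have E0 := cvg_unique (@norm_hausdorff _ R^o) (cvg_res _ _ _ Xw Jw Lw) X0.
  apply/esym/eqP; rewrite -subr_eq0; apply/eqP; rewrite -[RHS]E0; exact: addrC.
have [S cS dS] := H_separable.
have [g Sg] := countable_sub_range cS.
(* An enumeration of the rationals together with [T], which is the value at the code of [None] and
   at numbers that code nothing. *)
pose tau (n : nat) : R := if (choice.unpickle n : option (option rat)) is Some
  (Some q) then ratr q else T.
have X_eq_all : {ae P, forall w, forall n k, 0 < tau n <= T ->
    ip (g k) (path_fun (X w) (tau n) - sample_path L w (tau n)) =
    \int[lebesgue_measure]_(s in `[0, tau n]) ip (g k) (A' (path_fun (X w) s))}.
  apply: ae_foralln => n; apply: ae_foralln => k.
  have [tT|nT] := boolP (0 < tau n <= T); last exact: nearW.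
  by apply: filterS (X_eq (tau n) (g k) tT) => w.
apply: filterS3 X_good X'_good X_eq_all => w [_ X0 _ _] [_ X'0 X'weak _] Xall.
apply: cadlag_path_ext.
apply: (ou_unique ip_norm M'0 A'M T_gt0 (S := S) (D := range tau) dS _ _
  (path_cadlag (X w)) (path_cadlag (X' w)) _ X'weak).
- by exists (choice.pickle (None : option rat)) => //;
  rewrite /tau choice.pickleK.
- move=> a b _ ab _; have [q] := rat_in_itvoo ab; rewrite in_itv /= => qab.
  exists (ratr q) => //; exists (choice.pickle (Some q)) => //.
  by rewrite /tau choice.pickleK.
- by rewrite X0 X'0.
by move=> h t /Sg[k _ <-] [n _ <-]; exact: Xall.
Qed.
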